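(* There is an absolute constant $C>0$ such that the following holds. Let $n\ge 1$, let $X_1,\ldots,X_n$ be i.i.d. real random variables with a non-degenerate log-concave density that is symmetric about $0$, and let $\alpha,\beta\in\mathbb{R}^n$ with $\alpha\ne 0$. Then $$\mathbf{P}\{|\langle\alpha,X\rangle|\le|\langle\beta,X\rangle|\}\le C\,\frac{\|\beta\|}{\|\alpha\|}.$$
   Context: $X=(X_1,\ldots,X_n)$, $\langle\alpha,X\rangle=\sum_{i=1}^n\alpha_iX_i$, and $\|\cdot\|$ is the Euclidean norm. A density is log-concave if it is of the form $e^{-g}$ with $g$ convex, taking values in $(-\infty,+\infty]$. *)

(* Defs.v *)
From mathcomp Require Import all_boot all_order all_algebra.
From mathcomp Require Import all_classical all_reals all_analysis.

Set Implicit Arguments.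
Unset Strict Implicit.
Unset Printing Implicit Defensive.

Import Order.TTheory GRing.Theory Num.Theory.
Import numFieldNormedType.Exports.

Local Open Scope classical_set_scope.
Local Open Scope ring_scope.

(* [matrix] is equipped by the library with the sup norm; hence the explicit
   definition of the Euclidean one. *)
Definition euclid_norm (R : realType) (n : nat) (a : 'rV[R]_n) : R :=
  Num.sqrt (\sum_(i < n) a 0 i ^+ 2).

Definition lin_form (R : realType) (d : measure_display) (T : measurableType d)
    (P : probability T R) (n : nat) (a : 'rV[R]_n) (X : 'I_n -> {RV P >-> R})
    (w : T) : R :=
  \sum_(i < n) a 0 i * X i w.

Definition mutually_independent (R : realType) (d : measure_display)
    (T : measurableType d) (P : probability T R) (n : nat)
    (X : 'I_n -> {RV P >-> R}) : Prop :=
  forall (J : {set 'I_n}) (B : 'I_n -> set R),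
    (forall i, measurable (B i)) ->
    (P (\bigcap_(i in [set` J]) (X i @^-1` B i)) =
     \prod_(i in J) P (X i @^-1` B i))%E.

Definition identically_distributed (R : realType) (d : measure_display)
    (T : measurableType d) (P : probability T R) (n : nat)
    (X : 'I_n -> {RV P >-> R}) : Prop :=
  forall (i j : 'I_n) (B : set R), measurable B ->
    distribution P (X i) B = distribution P (X j) B.

Definition has_density (R : realType) (d : measure_display)
    (T : measurableType d) (P : probability T R) (Y : {RV P >-> R})
    (f : R -> R) : Prop :=
  [/\ measurable_fun setT f,
      (forall x, 0 <= f x) &
      forall B : set R, measurable B ->
        distribution P Y B = (\int[lebesgue_measure]_(x in B) (f x)%:E)%E].

(* For g without the value -oo the right-hand side is never of the form
   +oo - oo, and the convention 0 * +oo = 0 gives the usual meaning at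
   t = 0 and t = 1. *)
Definition convex_ereal (R : realType) (g : R -> \bar R) : Prop :=
  forall (x y t : R), 0 <= t <= 1 ->
    (g (t * x + (1 - t) * y)%R <= t%:E * g x + (1 - t)%:E * g y)%E.

Definition log_concave (R : realType) (f : R -> R) : Prop :=
  exists g : R -> \bar R,
    [/\ (forall x, (-oo < g x)%E),
        convex_ereal g &
        forall x, (f x)%:E = expeR (- g x)%E].

Definition even_function (R : realType) (f : R -> R) : Prop :=
  forall x, f (- x) = f x.

(* The law of Y is not a point mass. *)
Definition nondegenerate_law (R : realType) (d : measure_display)
    (T : measurableType d) (P : probability T R) (Y : {RV P >-> R}) : Prop :=
  ~ exists c : R, distribution P Y [set c] = 1%E.

(* Main.v *)
Require Import Defs.
From HB Require Import structures.
From mathcomp Require Import all_boot all_order all_algebra.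
From mathcomp Require Import all_classical all_reals all_analysis.
From mathcomp Require Import measurable_realfun measurable_fun_approximation.
From mathcomp Require Import ring lra.

(** Write S and V for the linear forms with coefficients a = alpha and
    b = beta, let M = f 0 be the value of the density at its mode, and let N and
    B be the norms of a and b.  The law of a coordinate lives at scale 1/M: its
    variance is at most 72/M^2 ([law_second_moment]) and f is at least M/96 on
    [-1/(8M), 1/(8M)] ([density_lower_bound]).

    The core is an integration by parts.  Were the score f'/f square
    integrable, one could take a function F(s,v) which behaves like s truncated
    to [-|v|, |v|], so that |F| is at most about |v|, its derivative in s is
    about the indicator of {|s| <= |v|}, and its derivative in v is bounded by
    1, and integrate the derivative of F(S,V) along the vector a:
      N^2 P(|S| <= |V|)  <~  | E F(S,V) Score |  +  <|a|,|b|>,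
    where Score is the sum of the a_i (f'/f)(X_i).  By orthogonality its norm in
    L^2 is of order M N, the norm of F(S,V) is of order B/M, and the right-hand
    side is of order N B: this is the claim, without the logarithm that bounding
    S and V separately would cost.

    The score of a log-concave density need not be a square integrable function
    (for the uniform law the derivative of f consists of two point masses at the
    ends of the support), so the derivative in coordinate i is weighted by h(X_i), where h = k/f for a parabola k supported where f >= M/96; then
    q = -k'/f is bounded by a constant times M ([score_exists]).  The factor N^2
    becomes the random weight H, the sum of the a_i^2 h(X_i), whose mean is
    N^2.  Where H >= N^2/2 the argument goes through ([large_weight_event]).

    Leave the largest coefficient a_0 out of H.  By Chebyshev's inequality
    H < N^2/2 has probability at most a constant times (a_0/N)^2
    ([small_weight_probability]), and that event depends only on the other
    coordinates.  Given these, X_0 alone makes |S| <= |V| unlikely: the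
    conditional probability is at most a constant times
    (M |V_0| + |b_0|) / |a_0|, where V_0 is V without its term in X_0
    ([law_small_ball]).  By the Cauchy-Schwarz inequality the average of this
    bound over an event of probability (a_0/N)^2 is of order B/N
    ([small_weight_event]). *)

Import Order.TTheory GRing.Theory Num.Theory.
Import numFieldNormedType.Exports.

Local Open Scope classical_set_scope.
Local Open Scope ring_scope.

Set Implicit Arguments.
Unset Strict Implicit.
Unset Printing Implicit Defensive.

(** * Measurability of the inverse and of the square root *)

Lemma measurable_funV d (T : measurableType d) (R : realType) (D : set T)
    (f : T -> R) :
  measurable_fun D f -> measurable_fun D (fun x => (f x)^-1).
Proof.
move=> mf; apply: (@measurableT_comp _ _ _ _ _ _ (@GRing.inv R)) mf.
rewrite -(setUv [set (0:R)]); apply/measurable_funU.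
- exact: measurable_set1.
- by apply: measurableC; exact: measurable_set1.
split; first exact: measurable_fun_set1.
apply: open_continuous_measurable_fun.
  by apply: closed_openC; apply: accessible_closed_set1; apply: hausdorff_accessible; exact: Rhausdorff.
by move=> x; rewrite inE => /= /eqP x0; exact: inv_continuous.
Qed.

Lemma measurable_fun_sqrt d (T : measurableType d) (R : realType) (D : set T)
    (f : T -> R) :
  measurable_fun D f -> measurable_fun D (fun x => Num.sqrt (f x)).
Proof.
move=> mf; apply: (@measurableT_comp _ _ _ _ _ _ (@Num.sqrt R)) mf.
by apply: continuous_measurable_fun; apply: sqrt_continuous.
Qed.

(** * Integrating out an independent random variable *)

Section disintegration.
Context d d2 (T : measurableType d) (T2 : measurableType d2) (R : realType).
Variables (P : probability T R) (X : {RV P >-> R}) (Y : {mfun T >-> T2}).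
Hypothesis indXY : forall A B, measurable A -> measurable B ->
  (P (X @^-1` A `&` Y @^-1` B) = P (X @^-1` A) * P (Y @^-1` B))%E.

Let XY (w : T) : R * T2 := (X w, Y w).

Let mXY : measurable_fun setT XY.
Proof. exact/measurable_fun_pairP. Qed.

Lemma joint_law_product (C : set (R * T2)) : measurable C ->
  pushforward P XY C = (distribution P X \x distribution P Y)%E C.
Proof.
move=> mC; apply/esym.
pose XYm : {mfun T >-> (R * T2)%type} := HB.pack XY (isMeasurableFun.Build _ _ _ _ XY mXY).
apply: (@product_measure_unique _ _ _ _ R (distribution P X) (distribution P Y)
  (distribution P XYm)) mC => A B mA mB.
by rewrite /distribution /pushforward /= -indXY.
Qed.

(** Independence makes the joint law of X and Y a product, so that X can be
    integrated out first, with Y frozen.  This is what reduces statements about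
    the whole vector to statements about the law of one coordinate. *)
Lemma disintegration (G : R * T2 -> R) : measurable_fun setT G ->
  P.-integrable setT (fun w => (G (X w, Y w))%:E) ->
  (\int[P]_w (G (X w, Y w))%:E =
   \int[P]_w \int[distribution P X]_x (G (x, Y w))%:E)%E.
Proof.
move=> mG iG.
have mG' : measurable_fun [set: R * T2] (EFin \o G : R * T2 -> \bar R).
  exact/measurable_EFinP.
have iG1 : (pushforward P XY).-integrable setT (EFin \o G : R * T2 -> \bar R).
  by apply: integrable_pushforward => //.
have iG2 : (distribution P X \x distribution P Y)%E.-integrable setT (EFin \o G : R * T2 -> \bar R).
  apply/integrableP; split => //.
  move/integrableP : iG1 => [_]; congr (_ < _)%E.
  by apply: eq_measure_integral => A mA _; exact: joint_law_product.
transitivity (\int[pushforward P XY]_z (EFin \o G) z)%E.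
  by rewrite integral_pushforward.
transitivity (\int[(distribution P X \x distribution P Y)%E]_z (EFin \o G) z)%E.
  by apply: eq_measure_integral => A mA _; exact: joint_law_product.
rewrite -integral21_prod_meas1//.
have mF : measurable_fun setT (fubini_G (distribution P X) (EFin \o G)).
  exact: (measurable_fubini_G iG2).
have iF : (distribution P Y).-integrable setT (fubini_G (distribution P X) (EFin \o G)).
  apply/integrableP; split => //.
  have lt21 := (integrable21ltyP (distribution P X) (distribution P Y) mG').1 iG2.
  apply: le_lt_trans lt21.
  apply: ge0_le_integral => //.
  - exact: measurableT_comp.
  - apply: (measurable_fun_fubini_tonelli_G (m1 := distribution P X)
      (abse \o (EFin \o G))) => [|z]; last exact: abse_ge0.
    exact: measurableT_comp.
  - move=> y _; apply: le_abse_integral => //.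
    exact: measurableT_comp.
rewrite integral_pushforward// preimage_setT.
apply/integrableP; split; first exact: measurableT_comp.
move/integrableP : iF => [_]; rewrite ge0_integral_pushforward//.
exact: measurableT_comp.
Qed.

Lemma disintegration_ge0 (G : R * T2 -> \bar R) : measurable_fun setT G ->
  (forall z, 0 <= G z)%E ->
  (\int[P]_w G (X w, Y w) =
   \int[P]_w \int[distribution P X]_x G (x, Y w))%E.
Proof.
move=> mG G0.
transitivity (\int[pushforward P XY]_z G z)%E.
  by rewrite ge0_integral_pushforward.
transitivity (\int[(distribution P X \x distribution P Y)%E]_z G z)%E.
  by apply: eq_measure_integral => A mA _; exact: joint_law_product.
rewrite fubini_tonelli2// ge0_integral_pushforward//.
  exact: measurable_fun_fubini_tonelli_G.
by move=> y _; apply: integral_ge0.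
Qed.

Lemma expectation_indep_product (phi : R -> R) (Z : T2 -> R) :
  measurable_fun setT phi -> measurable_fun setT Z ->
  P.-integrable setT (fun w => (phi (X w))%:E) ->
  P.-integrable setT (fun w => (Z (Y w))%:E) ->
  P.-integrable setT (fun w => (phi (X w) * Z (Y w))%:E) /\
  \int[P]_w (phi (X w) * Z (Y w)) =
    (\int[P]_w phi (X w)) * (\int[P]_w Z (Y w)).
Proof.
move=> mphi mZ iphi iZ.
have mG : measurable_fun [set: R * T2] (fun z : R * T2 => phi z.1 * Z z.2).
  by apply: measurable_funM; apply: measurableT_comp.
have mGa : measurable_fun [set: R * T2] (fun z : R * T2 => `|(phi z.1 * Z z.2)%:E|%E).
  by apply: measurableT_comp => //; exact/measurable_EFinP.
have mphia : measurable_fun setT (fun x => `|(phi x)%:E|%E).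
  by apply: measurableT_comp => //; exact/measurable_EFinP.
have mZa : measurable_fun setT (fun x => `|(Z x)%:E|%E).
  by apply: measurableT_comp => //; exact/measurable_EFinP.
have iphi' : (distribution P X).-integrable setT (EFin \o phi).
  by apply: integrable_pushforward => //; exact/measurable_EFinP.
have iG : P.-integrable setT (fun w => (phi (X w) * Z (Y w))%:E).
  apply/integrableP; split.
    apply/measurable_EFinP.
    by apply: measurable_funM; apply: measurableT_comp => //; exact: measurableT_comp.
  rewrite (disintegration_ge0 mGa)//=.
  under eq_integral.
    move=> w _; under eq_integral do rewrite normrM EFinM muleC.
    rewrite ge0_integralZl_EFin//=.
    over.
  rewrite ge0_integralZr//=; last 2 first.
  - exact: (measurableT_comp mZa).
  - exact: integral_ge0.
  apply: lte_mul_pinfty.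
  - exact: integral_ge0.
  - rewrite ge0_fin_numE; last exact: integral_ge0.
    by move/integrableP : iZ => [].
  - by move/integrableP : iphi' => [].
split => //.
rewrite /Rintegral (disintegration mG iG).
rewrite [in LHS](eq_integral (fun w => (Z (Y w))%:E *
    (\int[distribution P X]_x phi x)%:E)%E); last first.
  move=> w _ /=.
  rewrite (eq_integral (fun x => (Z (Y w))%:E * (phi x)%:E)%E); last first.
    by move=> x _; rewrite -EFinM mulrC.
  by rewrite integralZl//= fineK//; exact: integrable_fin_num.
rewrite integralZr//= fineM//; last exact: integrable_fin_num.
rewrite mulrC; congr (_ * _); rewrite /Rintegral integral_pushforward//.
exact/measurable_EFinP.
Qed.

End disintegration.

(** * One coordinate against all the others *)

Section other_coordinates.
Context (R : realType) d (T : measurableType d) (P : probability T R) (n : nat).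
Variables (X : 'I_n -> {RV P >-> R}) (i : 'I_n).

(** These cylinders form a pi-system generating the sigma-algebra of all the
    coordinates but the i-th one. *)
Definition other_cylinders : set (set T) :=
  [set A | exists2 B : 'I_n -> set R, forall j, measurable (B j) &
    A = \bigcap_(j in [set` [set~ i]%SET]) X j @^-1` B j].

(** The sample space itself, equipped with that smaller sigma-algebra: a
    function of the other coordinates is a measurable function on [others]. *)
Definition others : Type := g_sigma_algebraType other_cylinders.
HB.instance Definition _ := Measurable.on others.

Lemma other_cylinders_measurable A : other_cylinders A -> measurable A.
Proof.
move=> [B mB ->]; apply: fin_bigcap_measurable => // j _.
by rewrite -[_ @^-1` _]setTI; exact: measurable_funP.
Qed.

Lemma others_measurable (A : set others) : measurable A -> measurable (A : set T).
Proof.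
apply: smallest_sub.
  exact: sigma_algebra_measurable.
by move=> A' /other_cylinders_measurable.
Qed.

Definition to_others (w : T) : others := w.

Lemma to_others_measurable : measurable_fun [set: T] to_others.
Proof. by move=> _ A mA; rewrite setTI; exact: others_measurable. Qed.

HB.instance Definition _ :=
  isMeasurableFun.Build _ _ T others to_others to_others_measurable.

Lemma coord_others_measurable j : j != i -> measurable_fun [set: others] (X j).
Proof.
move=> ji _ B mB; rewrite setTI; apply: sub_sigma_algebra.
exists (fun k => if k == j then B else setT) => [k|]; first by case: ifP.
apply/seteqP; split => w /=.
  by move=> XB k _ /=; case: eqP => [->|].
by move=> /(_ j) /=; rewrite eqxx; apply; rewrite !inE.
Qed.

Lemma other_cylindersI : setI_closed other_cylinders.
Proof.
move=> _ _ [A mA ->] [B mB ->]; exists (fun j => A j `&` B j).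
  by move=> j; exact: measurableI.
by rewrite -bigcapI.
Qed.

Hypothesis indX : mutually_independent X.

(** The cylinders form a pi-system, on which the two finite measures
    P(X_i in A, .) and P(X_i in A) P(.) agree by mutual independence. *)
Lemma indep_others (A : set R) (B : set others) : measurable A -> measurable B ->
  (P (X i @^-1` A `&` to_others @^-1` B) =
   P (X i @^-1` A) * P (to_others @^-1` B))%E.
Proof.
move=> mA mB.
have mXA : measurable (X i @^-1` A).
  by rewrite -[_ @^-1` _]setTI; exact: measurable_funP.
pose m1' := [the {measure set others -> \bar R} of
  pushforward (mrestr P mXA) to_others].
pose m1 := m1' to_others_measurable.
pose m2 := [the {measure set others -> \bar R} of mscale (NngNum (fine_ge0 (measure_ge0 P (X i @^-1` A))))
  (distribution P [the {mfun T >-> others} of to_others])].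
have m1E C : measurable C -> m1 C = P (X i @^-1` A `&` to_others @^-1` C).
  by move=> mC; rewrite /m1 /pushforward /mrestr setIC.
have m2E C : measurable C -> m2 C = (P (X i @^-1` A) * P (to_others @^-1` C))%E.
  by move=> mC; rewrite /m2 /= /mscale /= fineK// fin_num_measure.
rewrite -m1E// -m2E//.
apply: (@measure_unique _ R others other_cylinders (fun=> setT)
  _ _ _ _ m1 m2 _ _ B mB) => //.
- exact: other_cylindersI.
- move=> _; exists (fun=> setT) => //.
  by apply/seteqP; split.
- by rewrite bigcup_const.
- move=> C CC; have [D mD CE] := CC.
  have mC : measurable (C : set others) by apply: sub_sigma_algebra.
  rewrite m1E// m2E//.
  rewrite CE.
  pose D' j := if j == i then A else D j.
  have mD' j : measurable (D' j) by rewrite /D'; case: ifP.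
  have D'E j : j != i -> D' j = D j by rewrite /D' => /negbTE ->.
  have D'i : D' i = A by rewrite /D' eqxx.
  have E1 : P (\bigcap_(j in [set` [set: 'I_n]%SET]) X j @^-1` D' j) =
      (P (X i @^-1` A) * \prod_(j | j != i) P (X j @^-1` D' j))%E.
    rewrite indX// (bigD1 i) ?inE//= D'i; congr (_ * _)%E.
    by apply: eq_bigl => j; rewrite inE.
  have E2 : P (\bigcap_(j in [set` [set~ i]%SET]) X j @^-1` D j) =
      (\prod_(j | j != i) P (X j @^-1` D' j))%E.
    rewrite indX//; apply: eq_big => j; first by rewrite !inE.
    by rewrite !inE => /D'E ->.
  transitivity (P (\bigcap_(j in [set` [set: 'I_n]%SET]) X j @^-1` D' j)); last first.
    by rewrite E1 -E2.
  congr (P _); apply/seteqP; split => w /=.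
    move=> [XA XD] j _ /=; have [->|ji] := eqVneq j i; first by rewrite /D' eqxx.
    by rewrite D'E//; apply: XD; rewrite /= !inE.
  move=> XD'; split; first by rewrite -D'i; apply: XD'; rewrite /= inE.
  by move=> j /=; rewrite !inE => /D'E <-; apply: XD'; rewrite /= inE.
- by move=> k; rewrite m1E// preimage_setT setIT ltey_eq fin_num_measure.
Qed.

End other_coordinates.

(** * Even log-concave densities *)

(** This function will dominate x^2 f(x), up to a factor. *)
Lemma integral_inverse_square (R : realType) (M : R) : 0 < M ->
  (\int[@lebesgue_measure R]_x ((1 + M * `|x|) ^- 2)%:E = (2 / M)%:E)%E.
Proof.
move=> M0.
have d0 (x : R) : 0 < 1 + M * `|x| by rewrite ltr_pwDl// mulr_ge0// ltW.
have cf : continuous (fun x : R => (1 + M * `|x|) ^- 2).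
  move=> x; apply: (@continuousV _ _ (fun x : R => (1 + M * `|x|) ^+ 2)).
    by rewrite gt_eqF// exprn_gt0.
  apply: cvgM; (apply: cvgD; [exact: cvg_cst|]);
    (apply: cvgM; [exact: cvg_cst|exact: norm_continuous]).
rewrite ge0_symfun_integralT//; last 2 first.
- by move=> x; rewrite invr_ge0 sqr_ge0.
- by move=> x /=; rewrite normrN.
rewrite -set_itvcy.
pose F (x : R) : R := - (M * (1 + M * x))^-1.
have dF (x : R) : 0 <= x -> is_derive x 1 F ((1 + M * `|x|) ^- 2).
  move=> x0; have x0' : 0 < 1 + M * x by have := d0 x; rewrite ger0_norm.
  rewrite /F.
  have h : M * (1 + M * x) != 0 by rewrite mulf_neq0// gt_eqF.
  apply: is_derive_eq.
  rewrite ger0_norm// /GRing.scale /=; field.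
  by rewrite !gt_eqF.
rewrite (@ge0_continuous_FTC2y _ _ F 0 0).
- rewrite /F mulr0 addr0 mulr1 -EFinB sub0r opprK -EFinM; congr (_%:E); ring.
- by move=> x _; rewrite invr_ge0 sqr_ge0.
- exact: continuous_subspaceT.
- rewrite -[X in _ --> X]oppr0; apply: cvgN; apply/gtr0_cvgV0.
    apply: (filterS _ (nbhs_pinfty_ge (num_real 0))) => x x0.
    by rewrite mulr_gt0// ltr_pwDl// mulr_ge0// ltW.
  apply: gt0_cvgMry => //; apply: (cvg_comp (fun x : R => M * x) _ _ (cvg_addrl 1)).
  by apply: gt0_cvgMry => //; exact: cvg_id.
- by move=> x x0; have [] := dF x (ltW x0).
- have : {for 0, continuous F}.
    by apply: differentiable_continuous; apply/derivable1_diffP; have [] := dF 0 (lexx _).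
  by move=> /cvg_at_right_filter.
- move=> x; rewrite in_itv/= andbT => x0.
  by rewrite derive1E; apply: derive_val; exact: dF (ltW x0).
Qed.

Section log_concave_even.
Context (R : realType) (f : R -> R).
Hypotheses (lcf : log_concave f) (evf : even_function f).

(** Where f is positive its convex potential is finite, so that the convexity
    inequality can be read between real numbers. *)
Lemma log_concave_weighted (x y t : R) : 0 <= t <= 1 -> 0 < f x -> 0 < f y ->
  exists s u v, [/\ f (t * x + (1 - t) * y) = expR (- s), f x = expR (- u),
    f y = expR (- v) & s <= t * u + (1 - t) * v].
Proof.
move=> t01 fx fy; have [g [gNy cg fE]] := lcf.
have fin z : 0 < f z -> exists2 r, g z = r%:E & f z = expR (- r).
  move=> fz; have := fE z; case gz : (g z) => [r| |] /=.
  - by move=> [fr]; exists r.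
  - by move=> [f0]; rewrite f0 ltxx in fz.
  - by have := gNy z; rewrite gz ltxx.
have [u gx fxE] := fin _ fx; have [v gy fyE] := fin _ fy.
have := cg x y t t01; rewrite gx gy -!EFinM -EFinD => le.
have := fE (t * x + (1 - t) * y); case gz : (g _) le => [s| |] //=.
- by rewrite lee_fin => le [fs]; exists s, u, v.
Qed.

Hypothesis f0 : forall x, 0 <= f x.

(** If |x| <= |y| then x lies between -y and y, where f takes the same value. *)
Lemma log_concave_even_noninc (x y : R) : `|x| <= `|y| -> f y <= f x.
Proof.
move=> xy; have [fy0|fy0] := ltP 0 (f y); last exact: le_trans fy0 (f0 x).
have [y0|y0] := eqVneq y 0.
  by move: xy; rewrite y0 normr0 normr_le0 => /eqP ->.
have fNy : 0 < f (- y) by rewrite evf.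
(* The weight for which x = t y + (1 - t)(-y). *)
pose t := (x / y + 1) / 2.
have : `|x / y| <= 1 by rewrite normrM normfV ler_pdivrMr ?normr_gt0// mul1r.
rewrite ler_norml => /andP[xy1 xy2].
have t01 : 0 <= t <= 1 by rewrite /t; apply/andP; split; lra.
have [s [u [v [fs fu fv suv]]]] := log_concave_weighted t01 fy0 fNy.
have uv : u = v.
  have : expR (- u) = expR (- v) by rewrite -fu -fv evf.
  by move=> /expR_inj/oppr_inj.
have xE : t * y + (1 - t) * - y = x by rewrite /t; field.
rewrite -xE fs fu ler_expR lerN2.
by rewrite (le_trans suv)// -uv -mulrDl addrC subrK mul1r.
Qed.

Lemma log_concave_even_half (x : R) : f x * f 0 <= f (x / 2) ^+ 2.
Proof.
have [fx0|fx0] := ltP 0 (f x); last first.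
  have -> : f x = 0 by apply/eqP; rewrite eq_le fx0 f0.
  by rewrite mul0r sqr_ge0.
have [fz0|fz0] := ltP 0 (f 0); last first.
  have -> : f 0 = 0 by apply/eqP; rewrite eq_le fz0 f0.
  by rewrite mulr0 sqr_ge0.
have t01 : 0 <= (1 / 2 : R) <= 1 by lra.
have [s [u [v [fs fu fv suv]]]] := log_concave_weighted t01 fx0 fz0.
have -> : x / 2 = 1 / 2 * x + (1 - 1 / 2) * 0 by field.
rewrite fs fu fv -expRD expr2 -expRD ler_expR; lra.
Qed.

Local Notation mu := (@lebesgue_measure R).
Hypotheses (mf : measurable_fun setT f) (int1 : (\int[mu]_x (f x)%:E = 1)%E).

Lemma mode_density_gt0 : 0 < f 0.
Proof.
rewrite lt_def f0 andbT; apply/eqP => fz.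
have fE x : f x = 0.
  apply/eqP; rewrite eq_le f0 andbT -fz; apply: log_concave_even_noninc.
  by rewrite normr0.
move: int1; under eq_integral do rewrite fE.
by rewrite integral0 => /esym/eqP; rewrite onee_eq0.
Qed.

(** On [-|x|, |x|] the density is at least f x, and its mass is at most 1. *)
Lemma even_noninc_density_bound (x : R) : 2 * `|x| * f x <= 1.
Proof.
suff : ((2 * `|x| * f x)%:E <= \int[mu]_y (f y)%:E)%E by rewrite int1 lee_fin.
have mI : measurable `[- `|x|, `|x|]%classic by exact: measurable_itv.
have h1 : ((2 * `|x| * f x)%:E <=
    \int[mu]_(y in `[(- `|x|)%R, `|x|%R]%classic) (f x)%:E)%E.
  rewrite integral_cst//= lebesgue_measure_itv/= lte_fin.
  case: ifPn => [_|]; first by rewrite -EFinD -EFinM lee_fin; lra.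
  rewrite -leNgt => h; have -> : `|x| = 0 by have := normr_ge0 x; lra.
  by rewrite mulr0 mul0r mule0.
apply: (le_trans h1).
apply: (@le_trans _ _ (\int[mu]_(y in `[(- `|x|)%R, `|x|%R]%classic) (f y)%:E)%E).
  apply: ge0_le_integral => //.
  - by move=> y _; rewrite lee_fin.
  - by apply/measurable_EFinP; exact: measurable_funTS.
  - move=> y; rewrite /= in_itv/= => yx; rewrite lee_fin.
    by apply: log_concave_even_noninc; rewrite ler_norml.
apply: ge0_subset_integral => //.
- exact/measurable_EFinP.
- by move=> y _; rewrite lee_fin.
Qed.

Local Notation M := (f 0).

(** The bound |y| f(y) <= 1/2 improves under f(y) M <= f(y/2)^2 to
    y^2 f(y) <= 1/M, and the same step once more gives the decay x^-4. *)
Lemma log_concave_even_tail (x : R) : x ^+ 4 * f x <= 16 / M ^+ 3.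
Proof.
have M0 := mode_density_gt0.
have b1 (y : R) : y ^+ 2 * f y <= M^-1.
  have h1 := even_noninc_density_bound (y / 2).
  have h2 := log_concave_even_half y.
  rewrite -[leRHS]mul1r ler_pdivlMr// -mulrA.
  apply: (le_trans (ler_wpM2l (sqr_ge0 y) h2)).
  rewrite -exprMn -[leRHS](expr1n _ 2) -real_normK ?num_real//.
  rewrite lerXn2r ?nnegrE ?normr_ge0// normrM (ger0_norm (f0 _)).
  move: h1; rewrite normrM (@ger0_norm _ 2^-1) ?invr_ge0//.
  by have -> : 2 * (`|y| / 2) * f (y / 2) = `|y| * f (y / 2) by field.
have h1 := b1 (x / 2); have h2 := log_concave_even_half x.
have h3 : x ^+ 4 * (f x * M) <= 16 * (M^-1) ^+ 2.
  have -> : 16 * M^-1 ^+ 2 = (4 * M^-1) ^+ 2 by rewrite exprMn; congr (_ * _); ring.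
  apply: (@le_trans _ _ ((4 * ((x / 2) ^+ 2 * f (x / 2))) ^+ 2)).
    have -> : (4 * ((x / 2) ^+ 2 * f (x / 2))) ^+ 2 = x ^+ 4 * f (x / 2) ^+ 2 by field.
    by rewrite ler_wpM2l// exprn_even_ge0.
  rewrite lerXn2r ?nnegrE//.
  - by do 2 apply: mulr_ge0 => //; exact: sqr_ge0.
  - by rewrite mulr_ge0// invr_ge0.
  - by rewrite ler_wpM2l.
rewrite ler_pdivlMr ?exprn_gt0//.
have -> : x ^+ 4 * f x * M ^+ 3 = x ^+ 4 * (f x * M) * M ^+ 2 by ring.
apply: (le_trans (ler_wpM2r _ h3)); first by rewrite sqr_ge0.
by rewrite -mulrA -exprMn mulVf ?expr1n ?mulr1// gt_eqF.
Qed.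

(** With u = M |x|, the mode bounds M x^2 f(x) by u^2 and the tail bounds it by
    16/u^2; both are at most 36/(1+u)^2 on their side of u = 2. *)
Lemma second_moment_density :
  (\int[mu]_x (x ^+ 2 * f x)%:E <= (72 / M ^+ 2)%:E)%E.
Proof.
have M0 := mode_density_gt0.
have d0 (x : R) : 0 < 1 + M * `|x| by rewrite ltr_pwDl// mulr_ge0// ltW.
have msq : measurable_fun setT (fun x : R => ((1 + M * `|x|) ^- 2)).
  apply: measurable_funV; apply: measurable_funX; apply: measurable_funD => //.
  by apply: measurable_funM => //; exact: normr_measurable.
have pt (x : R) : x ^+ 2 * f x <= 36 / M * (1 + M * `|x|) ^- 2.
  set u := M * `|x|.
  have u0 : 0 <= u by rewrite mulr_ge0// ltW.
  have xu : x ^+ 2 = u ^+ 2 / M ^+ 2.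
    by rewrite /u exprMn real_normK ?num_real// mulrAC mulfV ?mul1r// gt_eqF// exprn_gt0.
  have M20 : 0 < M ^+ 2 by rewrite exprn_gt0.
  have M30 : 0 < M ^+ 3 by rewrite exprn_gt0.
  rewrite -/u ler_pdivlMr ?exprn_gt0//; last exact: d0.
  rewrite ler_pdivlMr//.
  have [u2|u2] := leP u 2.
    apply: (@le_trans _ _ (u ^+ 2 / M ^+ 2 * M * (1 + u) ^+ 2 * M)).
      rewrite xu ler_wpM2r ?(ltW M0)// ler_wpM2r ?sqr_ge0// ler_wpM2l//.
        by rewrite divr_ge0 ?sqr_ge0.
      by apply: log_concave_even_noninc; rewrite normr0.
    have -> : u ^+ 2 / M ^+ 2 * M * (1 + u) ^+ 2 * M = (u * (1 + u)) ^+ 2.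
      by field; rewrite gt_eqF.
    have -> : 36 = 6 ^+ 2 :> R by rewrite -natrX.
    by rewrite lerXn2r ?nnegrE//; nra.
  have h := log_concave_even_tail x.
  have x4 : x ^+ 4 = u ^+ 4 / M ^+ 4.
    by rewrite -[4%N]/(2 * 2)%N !exprM xu; field; rewrite gt_eqF.
  have h' : u ^+ 4 * f x <= 16 * M.
    have -> : 16 * M = 16 / M ^+ 3 * M ^+ 4 by field; rewrite gt_eqF.
    have -> : u ^+ 4 * f x = x ^+ 4 * f x * M ^+ 4 by rewrite x4; field; rewrite gt_eqF.
    by rewrite ler_wpM2r// exprn_ge0// ltW.
  have u20 : 0 < u ^+ 2 by rewrite exprn_gt0//; lra.
  rewrite -(ler_pM2r u20).
  have -> : x ^+ 2 * f x * (1 + u) ^+ 2 * M * u ^+ 2 =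
    (u ^+ 4 * f x) * ((1 + u) ^+ 2 / M) by rewrite xu; field; rewrite gt_eqF.
  apply: (@le_trans _ _ (16 * M * ((1 + u) ^+ 2 / M))).
    by rewrite ler_wpM2r// divr_ge0 ?sqr_ge0// ltW.
  have -> : 16 * M * ((1 + u) ^+ 2 / M) = (4 * (1 + u)) ^+ 2 by field; rewrite gt_eqF.
  have -> : 36 * u ^+ 2 = (6 * u) ^+ 2 by ring.
  by rewrite lerXn2r ?nnegrE//; lra.
apply: (@le_trans _ _ (\int[mu]_x ((36 / M)%:E * ((1 + M * `|x|) ^- 2)%:E))%E).
  apply: ge0_le_integral => //.
  - by move=> x _; rewrite lee_fin mulr_ge0// sqr_ge0.
  - by apply/measurable_EFinP; apply: measurable_funM => //; exact: exprn_measurable.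
  - apply/measurable_EFinP; apply: measurable_funM => //; exact: mind.
  - by move=> x _; rewrite -EFinM lee_fin.
rewrite ge0_integralZl_EFin//.
- by rewrite integral_inverse_square// -EFinM lee_fin le_eqVlt; apply/orP; left; apply/eqP; field; rewrite gt_eqF.
- by move=> x _; rewrite lee_fin invr_ge0 sqr_ge0.
- exact/measurable_EFinP.
- by rewrite divr_ge0// ltW.
Qed.

(** Were f small at r = 1/(8M), the mass would be too small: it is at most
    2rM = 1/4 on [-r, r], at most 2 rho f(r) between r and rho, and at most
    72/(M rho)^2 beyond rho; the last is 1/2 for rho = 12/M. *)
Lemma density_lower_bound : M / 96 <= f (8 * M)^-1.
Proof.
have M0 := mode_density_gt0.
set r := (8 * M)^-1; pose rho := 12 / M.
have r0 : 0 < r by rewrite invr_gt0 mulr_gt0.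
have rho0 : 0 < rho by rewrite divr_gt0.
pose I (a : R) := `[- a, a]%classic.
have mI a : measurable (I a) by exact: measurable_itv.
have muI a : 0 < a -> mu (I a) = (2 * a)%:E.
  move=> a0; rewrite /I lebesgue_measure_itv/= lte_fin.
  by rewrite ifT; [rewrite -EFinD; congr (_%:E); ring|lra].
have pt (x : R) : f x <= M * \1_(I r) x + f r * \1_(I rho) x +
    (rho ^+ 2)^-1 * (x ^+ 2 * f x).
  have t0 : 0 <= (rho ^+ 2)^-1 * (x ^+ 2 * f x).
    by apply: mulr_ge0; [rewrite invr_ge0 sqr_ge0|apply: mulr_ge0 => //; exact: sqr_ge0].
  have fr0 := f0 r.
  have inI a : `|x| <= a -> \1_(I a) x = 1 :> R.
    by move=> xa; rewrite indicE mem_set// /I /= in_itv /= -ler_norml.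
  have [xr|xr] := leP `|x| r.
    have fx : f x <= M by apply: log_concave_even_noninc; rewrite normr0.
    rewrite (inI r)//.
    have : 0 <= f r * \1_(I rho) x :> R by rewrite mulr_ge0// indicE.
    lra.
  have fx : f x <= f r.
    by apply: log_concave_even_noninc; rewrite (gtr0_norm r0) ltW.
  have i0 : 0 <= M * \1_(I r) x :> R by rewrite mulr_ge0// indicE.
  have [xrho|xrho] := leP `|x| rho.
    rewrite (inI rho)//.
    lra.
  have i1 : 0 <= f r * \1_(I rho) x :> R by rewrite mulr_ge0// indicE.
  suff : f x <= (rho ^+ 2)^-1 * (x ^+ 2 * f x) by lra.
  rewrite mulrA ler_peMl// mulrC ler_pdivlMr ?exprn_gt0// mul1r.
  by rewrite -(real_normK (num_real x)) lerXn2r ?nnegrE// ltW.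
have mind a : measurable_fun setT (fun x => \1_(I a) x : R).
  exact: measurable_indic.
have m2 : measurable_fun setT (fun x : R => x ^+ 2 * f x).
  by apply: measurable_funM => //; exact: exprn_measurable.
have m2' : measurable_fun setT (fun x : R => (x ^+ 2 * f x)%:E) by exact/measurable_EFinP.
have rho20 : 0 <= (rho ^+ 2)^-1 by rewrite invr_ge0 sqr_ge0.
have intI a c : 0 <= c -> 0 < a ->
    (\int[mu]_x (c%:E * (\1_(I a) x)%:E) = c%:E * (2 * a)%:E)%E.
  move=> c0 a0; rewrite ge0_integralZl_EFin//.
  - rewrite integral_indic//.
    have -> : I a `&` [set: R] = I a by exact: setIT.
    by rewrite /= muI.
  - exact: mI.
  - by apply/measurable_EFinP; exact: mind.
have le1 : (1 <= M%:E * (2 * r)%:E + (f r)%:E * (2 * rho)%:E +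
    ((rho ^+ 2)^-1)%:E * (72 / M ^+ 2)%:E)%E.
  rewrite -int1.
  apply: (@le_trans _ _ (\int[mu]_x (M%:E * (\1_(I r) x)%:E +
     (f r)%:E * (\1_(I rho) x)%:E + ((rho ^+ 2)^-1)%:E * (x ^+ 2 * f x)%:E))%E).
    apply: ge0_le_integral => //.
    - by move=> x _; rewrite lee_fin.
    - exact/measurable_EFinP.
    - apply/measurable_EFinP; apply: measurable_funD; first apply: measurable_funD.
      + by apply: measurable_funM => //; exact: mind.
      + by apply: measurable_funM => //; exact: mind.
      + by apply: measurable_funM => //; exact: m2.
    - by move=> x _; rewrite -!EFinM -!EFinD lee_fin.
  rewrite ge0_integralD//=; last 4 first.
  - by move=> x _; rewrite -!EFinM -EFinD lee_fin addr_ge0// mulr_ge0// indicE.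
  - apply/measurable_EFinP; apply: measurable_funD; apply: measurable_funM => //; exact: mind.
  - move=> x _; rewrite -EFinM lee_fin; apply: mulr_ge0; first by rewrite invr_ge0 sqr_ge0.
    by apply: mulr_ge0 => //; exact: sqr_ge0.
  - apply/measurable_EFinP; apply: measurable_funM => //; exact: m2.
  rewrite ge0_integralD//=; last 4 first.
  - by move=> x _; rewrite -!EFinM lee_fin mulr_ge0// indicE.
  - apply/measurable_EFinP; apply: measurable_funM => //; exact: mind.
  - by move=> x _; rewrite -!EFinM lee_fin mulr_ge0// indicE.
  - apply/measurable_EFinP; apply: measurable_funM => //; exact: mind.
  rewrite !intI//; set J := (X in (_ + X)%E).
  have -> : J = (((rho ^+ 2)^-1)%:E * \int[mu]_x (x ^+ 2 * f x)%:E)%E.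
    rewrite /J; apply: ge0_integralZl_EFin => //.
    by move=> x _; rewrite lee_fin; apply: mulr_ge0 => //; exact: sqr_ge0.
  apply: leeD => //; apply: lee_wpmul2l; first by rewrite lee_fin.
  exact: second_moment_density.
move: le1; rewrite -!EFinM -!EFinD lee_fin => le1.
have E1 : M * (2 * r) = 1 / 4 by rewrite /r; field; rewrite gt_eqF.
have E2 : (rho ^+ 2)^-1 * (72 / M ^+ 2) = 1 / 2 by rewrite /rho; field; rewrite gt_eqF.
move: le1; rewrite E1 E2 => le1.
have : 1 / 4 <= f r * (2 * rho) by lra.
have -> : f r * (2 * rho) = 24 * (f r / M) by rewrite /rho; ring.
move=> h; have : 1 / 96 <= f r / M by lra.
by rewrite ler_pdivlMr// mul1r mulrC.
Qed.

End log_concave_even.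

(** * Expectations through a density *)

Section density.
Context d (T : measurableType d) (R : realType) (P : probability T R).
Variables (Y : {RV P >-> R}) (f : R -> R).
Hypothesis Yf : has_density Y f.
Local Notation mu := (@lebesgue_measure R).
Local Notation law := (distribution P Y).

Let mf : measurable_fun setT f. Proof. by have [] := Yf. Qed.
Let f0 x : 0 <= f x. Proof. by have [_ h _] := Yf; exact: h. Qed.
Let lawE B : measurable B -> (law B = \int[mu]_(x in B) (f x)%:E)%E.
Proof. by have [_ _ h] := Yf; exact: h. Qed.

Lemma integral_density1 : (\int[mu]_x (f x)%:E = 1)%E.
Proof. by rewrite -lawE// probability_setT. Qed.

Import HBNNSimple.

Let integral_density_nnsfun (phi : {nnsfun R >-> R}) :
  (\int[law]_x (phi x)%:E = \int[mu]_x ((phi x)%:E * (f x)%:E))%E.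
Proof.
have mf' : measurable_fun setT (EFin \o f) by exact/measurable_EFinP.
under [LHS]eq_integral do rewrite fimfunE -fsumEFin//.
rewrite [LHS]ge0_integral_fsum//; last 2 first.
  - by move=> r; exact/measurable_EFinP/measurableT_comp.
  - by move=> n x _; rewrite EFinM nnfun_muleindic_ge0.
under [RHS]eq_integral.
  move=> x xD; rewrite fimfunE -fsumEFin// ge0_mule_fsuml; last first.
    by move=> r; rewrite EFinM nnfun_muleindic_ge0.
  over.
rewrite [RHS]ge0_integral_fsum//; last 2 first.
  - move=> r; apply: emeasurable_funM => //.
    apply/measurable_EFinP; apply: measurable_funM => //.
    by apply: (@measurable_indic _ R R); exact: measurable_funPTI.
  - by move=> n x _; rewrite EFinM mule_ge0 ?nnfun_muleindic_ge0 ?lee_fin.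
apply: eq_fsbigr => r rphi.
have r0 : 0 <= r by move: rphi; rewrite inE => -[t _ <-].
have mA : measurable (phi @^-1` [set r]) by exact: measurable_funPTI.
rewrite (eq_integral (fun x => r%:E * (\1_(phi @^-1` [set r]) x)%:E)%E)//.
have -> : (\int[law]_x (r%:E * (\1_(phi @^-1` [set r]) x)%:E) =
    r%:E * law (phi @^-1` [set r]))%E.
  rewrite ge0_integralZl_EFin//.
  - by rewrite integral_indic// setIT.
  - by apply/measurable_EFinP; exact: measurable_indic.
rewrite lawE// -ge0_integralZl_EFin//.
- rewrite [LHS]integral_mkcond; apply: eq_integral => x _.
  rewrite patchE indicE; case: ifP => _; first by rewrite mulr1.
  by rewrite mulr0 mul0e.
- by move=> x _; rewrite lee_fin.
- by apply/measurable_EFinP; exact: measurable_funTS.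
Qed.

Lemma ge0_integral_density (phi : R -> \bar R) : measurable_fun setT phi ->
  (forall x, 0 <= phi x)%E ->
  (\int[law]_x phi x = \int[mu]_x (phi x * (f x)%:E))%E.
Proof.
move=> mphi phi0.
have mf' : measurable_fun setT (EFin \o f) by exact/measurable_EFinP.
pose h := nnsfun_approx measurableT mphi.
transitivity (lim (\int[law]_x (h n x)%:E @[n --> \oo])%E).
  rewrite -monotone_convergence//=.
  - apply: eq_integral => ? /[!inE] xD; apply/esym/cvg_lim => //=.
    exact: cvg_nnsfun_approx.
  - by move=> n; exact/measurable_EFinP/measurable_funTS.
  - by move=> n ? _; rewrite lee_fin.
  - by move=> ? _ ? ? mn; rewrite lee_fin; exact/lefP/nd_nnsfun_approx.
have mh n : measurable_fun setT (h n) by exact: measurable_funP.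
under eq_fun do rewrite integral_density_nnsfun.
rewrite -monotone_convergence//=.
- apply: eq_integral => x _; apply/cvg_lim => //.
  by apply: cvgeZr => //; exact: cvg_nnsfun_approx.
- by move=> n; apply: emeasurable_funM => //; apply/measurable_EFinP; exact: mh.
- by move=> n x _; rewrite mule_ge0// lee_fin.
- move=> x _ a b ab; apply: lee_wpmul2r; first by rewrite lee_fin.
  by rewrite lee_fin; have /lefP := nd_nnsfun_approx measurableT mphi ab; apply.
Qed.

(** Both sides split into the same positive and negative parts, finite or
    not. *)
Lemma integral_density (phi : R -> R) : measurable_fun setT phi ->
  (\int[law]_x (phi x)%:E = \int[mu]_x (phi x * f x)%:E)%E.
Proof.
move=> mphi; rewrite [LHS]integralE [RHS]integralE.
have mphi' : measurable_fun setT (EFin \o phi) by exact/measurable_EFinP.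
congr (_ - _)%E; rewrite ge0_integral_density//.
- apply: eq_integral => x _; rewrite !funeposE /=.
  by rewrite -!EFin_max -EFinM maxr_pMl// mul0r.
- exact: measurable_funepos.
- apply: eq_integral => x _; rewrite !funenegE /=.
  by rewrite -?EFinN -!EFin_max -EFinM maxr_pMl// mul0r mulNr.
- exact: measurable_funeneg.
Qed.

Lemma law_le_bound (A : set R) (c : R) : measurable A ->
  (forall x, A x -> f x <= c) -> (law A <= c%:E * mu A)%E.
Proof.
move=> mA fc; rewrite lawE//.
apply: (@le_trans _ _ (\int[mu]_(x in A) c%:E)%E); last by rewrite integral_cst.
apply: ge0_le_integral => //.
- by move=> x _; rewrite lee_fin.
- by apply/measurable_EFinP; exact: measurable_funTS.
Qed.

End density.

(** * A bounded substitute for the score *)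

(** With r = 1/(8M), let k be the parabola c (r^2 - x^2) on [-r, r], with c
    such that k has integral 1.  Then h = k/f and q = -k'/f turn the integration
    by parts of k against Lebesgue measure into one under the law of Y.  Both are
    bounded since f >= M/96 on [-r, r], even if f jumps to 0 right after r. *)
Section score.
Context d (T : measurableType d) (R : realType) (P : probability T R).
Variables (Y : {RV P >-> R}) (f : R -> R).
Hypotheses (Yf : has_density Y f) (lcf : log_concave f) (evf : even_function f).
Local Notation mu := (@lebesgue_measure R).
Local Notation law := (distribution P Y).
Local Notation M := (f 0).

Let mf : measurable_fun setT f. Proof. by have [] := Yf. Qed.
Let f0 x : 0 <= f x. Proof. by have [_ h _] := Yf; exact: h. Qed.
Let M0 : 0 < M.
Proof. exact: mode_density_gt0 lcf evf f0 (integral_density1 Yf). Qed.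

Let r : R := (8 * M)^-1.
Let r0 : 0 < r. Proof. by rewrite invr_gt0 mulr_gt0. Qed.
Let c : R := 3 / (4 * r ^+ 3).
Let c0 : 0 < c. Proof. by rewrite divr_gt0// mulr_gt0// exprn_gt0. Qed.

Let cut (k : R -> R) (x : R) : R := k x / f x * \1_(`[- r, r]%classic) x.
Let is_derive_continuous (G G' : R -> R) :
  (forall x : R, is_derive x 1 G (G' x)) -> continuous G.
Proof.
move=> dG x; apply: differentiable_continuous; apply/derivable1_diffP.
by have [] := dG x.
Qed.

Let derivable_is_derive (G G' : R -> R) (a b : R) :
  (forall x : R, is_derive x 1 G (G' x)) ->
  derivable_oo_LRcontinuous G a b /\ {in `]a, b[, derive1 G =1 G'}.
Proof.
move=> dG; have cG := is_derive_continuous dG.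
split; first split.
- by move=> x _; have [] := dG x.
- exact/cvg_at_right_filter/cG.
- exact/cvg_at_left_filter/cG.
- by move=> x _; rewrite derive1E; exact: derive_val.
Qed.

Let h := cut (fun x => c * (r ^+ 2 - x ^+ 2)).
Let q := cut (fun x => c * (2 * x)).

Let f_core x : x \in `[- r, r]%classic -> M / 96 <= f x.
Proof.
rewrite inE /= in_itv /= -ler_norml => xr.
apply: (le_trans (density_lower_bound lcf evf f0 mf (integral_density1 Yf))).
by apply: (log_concave_even_noninc lcf evf f0); rewrite (gtr0_norm r0).
Qed.

Let measurable_cut k : measurable_fun setT k -> measurable_fun setT (cut k).
Proof.
move=> mk; apply: measurable_funM; last exact: measurable_indic.
by apply: measurable_funM => //; exact: measurable_funV.
Qed.

Let cut_bound k b : (forall x, x \in `[- r, r]%classic -> `|k x| <= b) ->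
  0 <= b -> forall x, `|cut k x| <= b * (96 / M).
Proof.
move=> kb b0 x; rewrite /cut indicE.
have [xr|xr] := boolP (x \in _); last first.
  by rewrite mulr0 normr0 mulr_ge0// divr_ge0// ltW.
have fx := f_core xr.
have fx0 : 0 < f x by apply: lt_le_trans fx; rewrite divr_gt0.
rewrite mulr1 normrM normfV (gtr0_norm fx0).
apply: ler_pM => //; [by rewrite invr_ge0|exact: kb|].
by rewrite -[96 / M]invrK lef_pV2 ?posrE ?invr_gt0 ?divr_gt0// invf_div.
Qed.

Let integral_cut (k G : R -> R) : measurable_fun setT k ->
  measurable_fun setT G ->
  (\int[law]_x (cut k x * G x)%:E = \int[mu]_(x in `[(- r)%R, r]) (k x * G x)%:E)%E.
Proof.
move=> mk mG; rewrite (integral_density Yf); last first.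
  by apply: measurable_funM => //; exact: measurable_cut.
rewrite [RHS]integral_mkcond; apply: eq_integral => x _.
rewrite patchE /cut indicE; case: ifPn => [xr|_]; last by rewrite mulr0 !mul0r.
have fx0 : 0 < f x by apply: lt_le_trans (f_core xr); rewrite divr_gt0.
by congr (_%:E); rewrite /=; field; rewrite gt_eqF.
Qed.

Lemma score_exists : exists h q : R -> R,
  [/\ measurable_fun setT h, measurable_fun setT q,
      (forall x, 0 <= h x <= 576), (forall x, `|q x| <= 9216 * M) &
      (\int[law]_x (h x)%:E = 1)%E] /\
  forall G G' : R -> R, (forall x : R, is_derive x 1 G (G' x)) ->
    continuous G' ->
    (\int[law]_x (h x * G' x)%:E = \int[law]_x (q x * G x)%:E)%E.
Proof.
have mh : measurable_fun setT (fun x : R => c * (r ^+ 2 - x ^+ 2)).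
  apply: measurable_funM => //; apply: measurable_funB => //.
have mq : measurable_fun setT (fun x : R => c * (2 * x)).
  by apply: measurable_funM => //; apply: measurable_funM.
have x2 x : x \in `[- r, r]%classic -> x ^+ 2 <= r ^+ 2 /\ `|x| <= r.
  rewrite inE /= in_itv /= -ler_norml => xr; split => //.
  by rewrite -(real_normK (num_real x)) lerXn2r ?nnegrE// ltW.
have dk (x : R) : is_derive x 1 (fun x : R => c * (r ^+ 2 - x ^+ 2)) (- (c * (2 * x))).
  by apply: is_derive_eq; rewrite /GRing.scale /=; ring.
exists h, q; split; first split.
- exact: measurable_cut.
- exact: measurable_cut.
- move=> x; apply/andP; split.
    rewrite /h /cut indicE; have [xr|_] := boolP (x \in _); last by rewrite mulr0.
    have [xr2 _] := x2 _ xr.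
    by rewrite mulr1 divr_ge0// mulr_ge0 ?(ltW c0)// subr_ge0.
  apply: le_trans (ler_norm _) _.
  (* 576 is k(0) times the bound 96/M on 1/f. *)
  have -> : 576 = c * r ^+ 2 * (96 / M) by rewrite /c /r; field; rewrite gt_eqF.
  apply: cut_bound; last by rewrite mulr_ge0 ?sqr_ge0// ltW.
  move=> y yr; have [yr2 _] := x2 _ yr.
  rewrite normrM (gtr0_norm c0) ler_wpM2l ?(ltW c0)// ger0_norm ?subr_ge0//.
  by rewrite gerBl sqr_ge0.
- move=> x.
  have -> : 9216 * M = c * (2 * r) * (96 / M) by rewrite /c /r; field; rewrite gt_eqF.
  apply: cut_bound; last by rewrite mulr_ge0 ?(ltW c0)// mulr_ge0// ltW.
  move=> y yr; have [_ yr1] := x2 _ yr.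
  by rewrite normrM (gtr0_norm c0) ler_wpM2l ?(ltW c0)// normrM ger0_norm// ler_wpM2l.
- transitivity (\int[mu]_(x in `[(- r)%R, r]) (c * (r ^+ 2 - x ^+ 2))%:E)%E.
    have := integral_cut mh (@measurable_cst _ _ R R setT 1).
    by under eq_integral do rewrite mulr1; under [in RHS]eq_integral do rewrite mulr1.
  have dF (x : R) : is_derive x 1 (fun x : R => c * (r ^+ 2 * x - x ^+ 3 / 3))
      (c * (r ^+ 2 - x ^+ 2)).
    apply: is_derive_eq; rewrite /GRing.scale /=; by field.
  have [dF1 dF2] := derivable_is_derive (- r) r dF.
  rewrite (continuous_FTC2 _ _ dF1 dF2).
  + by rewrite -EFinB /c; congr (_%:E); field; rewrite gt_eqF.
  + by rewrite -subr_gt0 opprK addr_gt0.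
  + exact/continuous_subspaceT/(is_derive_continuous dk).
move=> G G' dG cG'.
have mG' : measurable_fun setT G' by exact: continuous_measurable_fun.
have cG := is_derive_continuous dG.
have mG : measurable_fun setT G by exact: continuous_measurable_fun.
rewrite !integral_cut//.
have [dk1 dk2] := derivable_is_derive (- r) r dk.
have [dG1 dG2] := derivable_is_derive (- r) r dG.
have c2 : continuous (fun x : R => c * (2 * x)).
  by move=> x; apply: cvgM; [exact: cvg_cst|apply: cvgM; [exact: cvg_cst|exact: cvg_id]].
rewrite (@integration_by_parts _ _ G (fun x => - (c * (2 * x))) G')//.
- have -> : c * (r ^+ 2 - r ^+ 2) * G r - c * (r ^+ 2 - (- r) ^+ 2) * G (- r) = 0 by ring.
  rewrite sub0e.
  have icG : mu.-integrable `[(- r)%R, r] (fun x => (c * (2 * x) * G x)%:E).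
    apply: continuous_compact_integrable; first exact: segment_compact.
    by apply: continuous_subspaceT => x; apply: cvgM; [exact: c2|exact: cG].
  have -> : (\int[mu]_(x in `[(- r)%R, r]) (- (c * (2 * x)) * G x)%:E =
      - \int[mu]_(x in `[(- r)%R, r]) (c * (2 * x) * G x)%:E)%E.
    rewrite -mulN1e -EFinN -integralZl//; apply: eq_integral => x _.
    by rewrite -EFinM mulNr mulN1r.
  by rewrite oppeK.
- by rewrite -subr_gt0 opprK addr_gt0.
- by apply: continuous_subspaceT => x; apply: cvgN; exact: c2.
- exact: continuous_subspaceT.
Qed.

End score.

(** * Moments and small balls of a coordinate *)

Section law_estimates.
Context d (T : measurableType d) (R : realType) (P : probability T R).
Variables (Y : {RV P >-> R}) (f : R -> R).
Hypotheses (Yf : has_density Y f) (lcf : log_concave f) (evf : even_function f).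
Local Notation mu := (@lebesgue_measure R).
Local Notation law := (distribution P Y).
Local Notation M := (f 0).

Let mf : measurable_fun setT f. Proof. by have [] := Yf. Qed.
Let f0 x : 0 <= f x. Proof. by have [_ h _] := Yf; exact: h. Qed.
Let M0 : 0 < M.
Proof. exact: mode_density_gt0 lcf evf f0 (integral_density1 Yf). Qed.

Lemma law_second_moment : (\int[law]_x (x ^+ 2)%:E <= (72 / M ^+ 2)%:E)%E.
Proof.
rewrite (integral_density Yf); last exact: exprn_measurable.
exact: second_moment_density lcf evf f0 mf (integral_density1 Yf).
Qed.

(** The substitution x -> -x exchanges the positive and negative parts of
    x f(x), which have finite integrals. *)
Lemma law_mean0 : (\int[law]_x x%:E = 0)%E.
Proof.
rewrite (integral_density Yf)// integralE.
have m1 : measurable_fun setT (fun x : R => (x * f x)%:E).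
  by apply/measurable_EFinP; apply: measurable_funM.
have -> : (\int[mu]_x ((fun x : R => (x * f x)%:E)^\- x) =
           \int[mu]_x ((fun x : R => (x * f x)%:E)^\+ x))%E.
  rewrite [LHS](_ : _ = \int[pushforward mu (-%R : _ -> measurableTypeR R)]_x
      ((fun x : R => (x * f x)%:E)^\- x))%E; last first.
    by apply: eq_measure_integral => A mA _; exact/esym/lebesgue_measureN.
  rewrite ge0_integral_pushforward//=; last first.
    exact: measurable_funeneg.
  apply: eq_integral => x _; rewrite /= funenegE funeposE.
  by rewrite evf mulNr EFinN oppeK.
rewrite subee//.
apply: integrable_pos_fin_num => //.
apply: (@le_integrable _ _ _ mu setT measurableT _ (fun x => (f x + x ^+ 2 * f x)%:E)) => //.
  move=> x _ /=; rewrite lee_fin normrM (ger0_norm (f0 x)).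
  rewrite [X in _ <= X]ger0_norm; last first.
    by rewrite addr_ge0// mulr_ge0// sqr_ge0.
  have -> : f x + x ^+ 2 * f x = (1 + x ^+ 2) * f x by ring.
  rewrite ler_wpM2r// -(real_normK (num_real x)).
  by have := sqr_ge0 (`|x| - 1); rewrite sqrrB expr1n; have := normr_ge0 x; nra.
have m2 : measurable_fun setT (fun x : R => (x ^+ 2 * f x)%:E).
  by apply/measurable_EFinP; apply: measurable_funM => //; exact: exprn_measurable.
have x2f x : 0 <= x ^+ 2 * f x by apply: mulr_ge0 => //; exact: sqr_ge0.
under eq_fun do rewrite EFinD.
apply: integrableD => //; apply/integrableP; split => //.
- exact/measurable_EFinP.
- under eq_integral do rewrite /= ger0_norm//.
  by rewrite (integral_density1 Yf) ltry.
- under eq_integral do rewrite /= ger0_norm//.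
  apply: le_lt_trans (second_moment_density lcf evf f0 mf (integral_density1 Yf)) _.
  by rewrite ltry.
Qed.

(** Put y = s/a.  The event confines x to an interval around -y of length of
    order (|b| |y| + |t|)/|a|.  If |t| dominates, f <= M suffices.  Otherwise the
    event forces |x| >= (2/5) |y|, where f <= 1/(2|x|): this cancels the
    factor |y| in front of |b|, which may be large. *)
Lemma law_small_ball (a b s t : R) : a != 0 -> `|b| <= `|a| / 4 ->
  (law [set x | (`|a * x + s| <= `|b * x + t|)%R] <=
   (4 * (M * `|t| + `|b|) / `|a|)%:E)%E.
Proof.
move=> a0 ba.
set A := [set x | _].
have na0 : 0 < `|a| by rewrite normr_gt0.
have mA : measurable A.
  rewrite /A -[X in measurable X]setTI.
  by apply: measurable_fun_ler => //; apply: measurableT_comp => //;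
    apply: measurable_funD => //; apply: measurable_funM.
pose y := s / a; pose de := `|b| / `|a|; pose tau := `|t| / `|a|.
have de0 : 0 <= de by rewrite divr_ge0.
have tau0 : 0 <= tau by rewrite divr_ge0.
have de4 : de <= 1 / 4 by rewrite ler_pdivrMr// mul1r mulrC.
have Ade x : A x -> `|x + y| <= de * `|x| + tau.
  rewrite /A /= => h; rewrite -(ler_pM2l na0) -normrM.
  have -> : a * (x + y) = a * x + s by rewrite /y; field.
  apply: (le_trans h); apply: (le_trans (ler_normD _ _)).
  by rewrite normrM mulrDr mulrA /de /tau !(mulrCA `|a|) !mulfV ?gt_eqF// !mulr1.
pose rho := 4 / 3 * (de * `|y| + tau).
have Arho x : A x -> `|x + y| <= rho.
  move=> /Ade h; have : `|x| <= `|x + y| + `|y|.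
    by rewrite -{1}(addrK y x) (le_trans (ler_normB _ _)).
  rewrite /rho => h1; have : de * `|x| <= de * (`|x + y| + `|y|) by rewrite ler_wpM2l.
  have : de * `|x + y| <= 1 / 4 * `|x + y| by rewrite ler_wpM2r.
  rewrite mulrDr; lra.
have rho0 : 0 <= rho by rewrite /rho mulr_ge0// addr_ge0// mulr_ge0.
have muA : (mu A <= (2 * rho)%:E)%E.
  apply: (@le_trans _ _ (mu `[(- y - rho)%R, (- y + rho)%R]%classic)).
    apply: le_measure; rewrite ?inE//.
    move=> x /Arho; rewrite ler_norml /= in_itv /=; lra.
  rewrite lebesgue_measure_itv /= lte_fin; case: ifPn => _.
    by rewrite -EFinD lee_fin; lra.
  by rewrite lee_fin mulr_ge0.
have bnd c : 0 <= c -> (forall x, A x -> f x <= c) -> (law A <= (c * (2 * rho))%:E)%E.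
  move=> c0 fc; apply: (le_trans (law_le_bound Yf mA fc)).
  by rewrite EFinM lee_wpmul2l.
have goalE : 4 * (M * `|t| + `|b|) / `|a| = 4 * (M * tau) + 4 * de.
  by rewrite /tau /de; ring.
rewrite goalE.
have fM x : f x <= M.
  by apply: (log_concave_even_noninc lcf evf f0); rewrite normr0.
have [ty|ty] := leP (`|y| / 2) tau.
  apply: (le_trans (bnd M (ltW M0) (fun x _ => fM x))); rewrite lee_fin.
  have h1 : de * `|y| <= 1 / 4 * `|y| by rewrite ler_wpM2r.
  have : M * rho <= M * (2 * tau) by rewrite ler_wpM2l ?(ltW M0)// /rho; lra.
  lra.
have y0 : 0 < `|y| by lra.
(* M serves the part of the interval due to t, the other one that due to b. *)
pose c := Num.min M (5 / (4 * `|y|)).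
have c1 : 0 <= c by rewrite le_min (ltW M0) divr_ge0// mulr_ge0.
have fc x : A x -> f x <= c.
  move=> Ax; rewrite le_min fM /=.
  have h := Ade _ Ax.
  have hy : `|y| <= `|x + y| + `|x|.
    by rewrite -{1}(addKr x y) addrC (le_trans (ler_normB _ _)).
  have hx : de * `|x| <= 1 / 4 * `|x| by rewrite ler_wpM2r.
  have xy : 2 / 5 * `|y| <= `|x| by lra.
  have b1 := even_noninc_density_bound lcf evf f0 mf (integral_density1 Yf) x.
  rewrite ler_pdivlMr ?mulr_gt0//.
  have : f x * (2 / 5 * `|y|) <= f x * `|x| by rewrite ler_wpM2l.
  lra.
apply: (le_trans (bnd c c1 fc)); rewrite lee_fin.
have cM : c <= M by rewrite ge_min lexx.
have cy : c * `|y| <= 5 / 4.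
  have : c <= 5 / (4 * `|y|) by rewrite ge_min lexx orbT.
  by rewrite ler_pdivlMr ?mulr_gt0// => h; lra.
have h1 : de * (c * `|y|) <= de * (5 / 4) by rewrite ler_wpM2l.
have h2 : c * tau <= M * tau by rewrite ler_wpM2r.
have h3 : 0 <= M * tau by rewrite mulr_ge0.
have -> : c * (2 * rho) = 8 / 3 * (de * (c * `|y|)) + 8 / 3 * (c * tau).
  by rewrite /rho; field.
lra.
Qed.

End law_estimates.

(** * A smooth truncation *)

Section soft_clamp.
Context (R : realType) (eta : R).
Hypothesis eta0 : 0 < eta.

Definition clamp_tau (t : R) : R := Num.sqrt (t ^+ 2 + eta ^+ 2).
Definition clamp_rho (s t : R) : R := Num.sqrt (s ^+ 2 + t ^+ 2 + eta ^+ 2).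
(** A smooth version of s truncated to [-|t|, |t|].  The parameter eta keeps
    it differentiable at t = 0. *)
Definition clamp (s t : R) : R := s * clamp_tau t / clamp_rho s t.
(** The partial derivatives of [clamp] are [clamp_ds] and [clamp_dt]. *)
Definition clamp_ds (s t : R) : R := (clamp_tau t / clamp_rho s t) ^+ 3.
Definition clamp_dt (s t : R) : R := t / clamp_tau t * (s / clamp_rho s t) ^+ 3.

Let tau2_gt0 t : 0 < t ^+ 2 + eta ^+ 2.
Proof. by rewrite ltr_wpDl ?sqr_ge0// exprn_gt0. Qed.
Let rho2_gt0 s t : 0 < s ^+ 2 + t ^+ 2 + eta ^+ 2.
Proof. by rewrite ltr_wpDl ?addr_ge0 ?sqr_ge0// exprn_gt0. Qed.
Let tau_gt0 t : 0 < clamp_tau t. Proof. by rewrite sqrtr_gt0. Qed.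
Let rho_gt0 s t : 0 < clamp_rho s t. Proof. by rewrite sqrtr_gt0. Qed.
Let tau2 t : clamp_tau t ^+ 2 = t ^+ 2 + eta ^+ 2.
Proof. by rewrite sqr_sqrtr// ltW. Qed.
Let rho2 s t : clamp_rho s t ^+ 2 = s ^+ 2 + t ^+ 2 + eta ^+ 2.
Proof. by rewrite sqr_sqrtr// ltW. Qed.

Let ratio_le1 (x y : R) : 0 < y -> x ^+ 2 <= y ^+ 2 -> `|x / y| <= 1.
Proof.
move=> y0 xy; rewrite normrM normfV (gtr0_norm y0) ler_pdivrMr// mul1r.
by rewrite -(gtr0_norm y0) -ler_sqr ?nnegrE// !real_normK ?num_real.
Qed.

Lemma clamp_sqr_le s t : clamp s t ^+ 2 <= t ^+ 2 + eta ^+ 2.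
Proof.
rewrite -tau2 /clamp mulrAC exprMn -[leRHS]mul1r ler_wpM2r ?sqr_ge0//.
rewrite -real_normK ?num_real// expr_le1// ratio_le1// rho2.
by rewrite -addrA lerDl addr_ge0// sqr_ge0.
Qed.

Lemma clamp_ds_ge0 s t : 0 <= clamp_ds s t.
Proof. by rewrite exprn_ge0// divr_ge0// ltW. Qed.

Lemma clamp_ds_le1 s t : clamp_ds s t <= 1.
Proof.
rewrite exprn_ile1// ?divr_ge0 ?(ltW (tau_gt0 _)) ?(ltW (rho_gt0 _ _))//.
rewrite (le_trans (ler_norm _))// ratio_le1// tau2 rho2.
by rewrite -addrA lerDr sqr_ge0.
Qed.

Lemma clamp_dt_le1 s t : `|clamp_dt s t| <= 1.
Proof.
rewrite /clamp_dt normrM normrX mulr_ile1// ?exprn_ge0//.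
  by rewrite ratio_le1// tau2 lerDl sqr_ge0.
by rewrite exprn_ile1// ratio_le1// rho2 -addrA lerDl addr_ge0// sqr_ge0.
Qed.

Lemma clamp_ds_lower s t : `|s| <= `|t| -> 1 / 3 <= clamp_ds s t.
Proof.
move=> st; rewrite /clamp_ds; set u := clamp_tau t / _.
have u0 : 0 <= u by rewrite divr_ge0// ltW.
have u2 : 1 / 2 <= u ^+ 2.
  rewrite /u exprMn exprVn tau2 rho2 ler_pdivlMr//.
  have : s ^+ 2 <= t ^+ 2.
    by rewrite -(real_normK (num_real s)) -(real_normK (num_real t)) lerXn2r ?nnegrE.
  by have := sqr_ge0 eta; lra.
have u23 : 2 / 3 <= u.
  rewrite leNgt; apply/negP => h; have : u ^+ 2 < (2 / 3) ^+ 2 by rewrite ltrXn2r.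
  by move: u2; nra.
by rewrite exprS; nra.
Qed.

Lemma is_derive_clamp_line (a s0 b t0 x : R) :
  is_derive x 1 (fun x : R => clamp (a * x + s0) (b * x + t0))
    (a * clamp_ds (a * x + s0) (b * x + t0) +
     b * clamp_dt (a * x + s0) (b * x + t0)).
Proof.
have d1 : is_derive x 1 (fun y : R => clamp_tau (b * y + t0))
    (b * (b * x + t0) / clamp_tau (b * x + t0)).
  have h := tau2_gt0 (b * x + t0).
  have dg : is_derive x 1 (fun y : R => (b * y + t0) ^+ 2 + eta ^+ 2)
      (2 * b * (b * x + t0)).
    by apply: is_derive_eq; rewrite /GRing.scale /=; ring.
  have dd : is_derive x 1 (fun y : R => clamp_tau (b * y + t0)) _ :=
    @is_derive1_comp _ (@Num.sqrt R) (fun y : R => (b * y + t0) ^+ 2 + eta ^+ 2)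
      x _ _ (is_derive1_sqrt h) dg.
  apply: (is_derive_eq dd).
  by rewrite -/(clamp_tau _); field; rewrite gt_eqF.
have d2 : is_derive x 1 (fun y : R => clamp_rho (a * y + s0) (b * y + t0))
    ((a * (a * x + s0) + b * (b * x + t0)) / clamp_rho (a * x + s0) (b * x + t0)).
  have h := rho2_gt0 (a * x + s0) (b * x + t0).
  have dg : is_derive x 1
      (fun y : R => (a * y + s0) ^+ 2 + (b * y + t0) ^+ 2 + eta ^+ 2)
      (2 * (a * (a * x + s0) + b * (b * x + t0))).
    by apply: is_derive_eq; rewrite /GRing.scale /=; ring.
  have dd : is_derive x 1 (fun y : R => clamp_rho (a * y + s0) (b * y + t0)) _ :=
    @is_derive1_comp _ (@Num.sqrt R)
      (fun y : R => (a * y + s0) ^+ 2 + (b * y + t0) ^+ 2 + eta ^+ 2)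
      x _ _ (is_derive1_sqrt h) dg.
  apply: (is_derive_eq dd).
  by rewrite -/(clamp_rho _ _); field; rewrite gt_eqF.
have d3 := @is_deriveV R (fun y : R => clamp_rho (a * y + s0) (b * y + t0)) x _ _
  (negbT (gt_eqF (rho_gt0 (a * x + s0) (b * x + t0)))) d2.
have d4 : is_derive x 1 (fun y : R => a * y + s0) a.
  by apply: is_derive_eq; rewrite /GRing.scale /=; ring.
have d5 := @is_deriveM _ _ (fun y : R => a * y + s0)
  (fun y : R => clamp_tau (b * y + t0)) x 1 _ _ d4 d1.
have d6 : is_derive x 1 (fun y : R => clamp (a * y + s0) (b * y + t0)) _ :=
  @is_deriveM _ _ (fun y : R => (a * y + s0) * clamp_tau (b * y + t0))
  (fun y : R => (clamp_rho (a * y + s0) (b * y + t0))^-1) x 1 _ _ d5 d3.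
apply: (is_derive_eq d6).
have := rho2 (a * x + s0) (b * x + t0).
have := tau2 (b * x + t0).
have := rho_gt0 (a * x + s0) (b * x + t0).
have := tau_gt0 (b * x + t0).
rewrite /clamp_ds /clamp_dt /GRing.scale /=.
set s := a * x + s0; set t := b * x + t0.
set tau := clamp_tau t; set rho := clamp_rho s t => tau0 rho0 tE rE.
have rE' : rho ^+ 2 = s ^+ 2 + tau ^+ 2 by rewrite rE tE addrA.
transitivity ((a * tau * rho ^+ 2 + b * t * s * rho ^+ 2 / tau
   - s * tau * (a * s + b * t)) / rho ^+ 3).
  by field; rewrite !gt_eqF.
by rewrite rE'; field; rewrite !gt_eqF.
Qed.

Lemma continuous_clamp_line_derive (a s0 b t0 : R) : continuous (fun x : R =>
    a * clamp_ds (a * x + s0) (b * x + t0) +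
    b * clamp_dt (a * x + s0) (b * x + t0)).
Proof.
have cl (u v : R) : continuous (fun x : R => u * x + v).
  move=> x; apply: cvgD; last exact: cvg_cst.
  by apply: cvgM; [exact: cvg_cst|exact: cvg_id].
have csq (g : R -> R) : continuous g -> continuous (fun x => g x ^+ 2).
  by move=> cg x; apply: cvgM; exact: cg.
have ccb (g : R -> R) : continuous g -> continuous (fun x => g x ^+ 3).
  by move=> cg x; do 2 (apply: cvgM; first exact: cg); exact: cg.
have csqrt (g : R -> R) : continuous g -> continuous (fun x => Num.sqrt (g x)).
  by move=> cg x; apply: continuous_comp; [exact: cg|exact: sqrt_continuous].
have ctau : continuous (fun x : R => clamp_tau (b * x + t0)).
  apply: csqrt => x; apply: cvgD; last exact: cvg_cst.
  exact: (csq _ (cl b t0)).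
have crho : continuous (fun x : R => clamp_rho (a * x + s0) (b * x + t0)).
  apply: csqrt => x; apply: cvgD; last exact: cvg_cst.
  by apply: cvgD; [exact: (csq _ (cl a s0))|exact: (csq _ (cl b t0))].
have cdiv (g k : R -> R) : (forall x, k x != 0) -> continuous g -> continuous k ->
    continuous (fun x => g x / k x).
  by move=> k0 cg ck x; apply: cvgM; [exact: cg|apply: cvgV; [exact: k0|exact: ck]].
have rho0 x : clamp_rho (a * x + s0) (b * x + t0) != 0 by rewrite gt_eqF.
have tau0 x : clamp_tau (b * x + t0) != 0 by rewrite gt_eqF.
have cds : continuous (fun x : R => clamp_ds (a * x + s0) (b * x + t0)).
  exact: (ccb _ (cdiv _ _ rho0 ctau crho)).
have cdt : continuous (fun x : R => clamp_dt (a * x + s0) (b * x + t0)).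
  move=> x; apply: cvgM; first exact: (cdiv _ _ tau0 (cl b t0) ctau).
  exact: (ccb _ (cdiv _ _ rho0 (cl a s0) crho)).
move=> x; apply: cvgD; (apply: cvgM; first exact: cvg_cst); [exact: cds|exact: cdt].
Qed.

Section measurability.
Context d (T : measurableType d) (s t : T -> R).
Hypotheses (ms : measurable_fun setT s) (mt : measurable_fun setT t).

Let mtau : measurable_fun setT (fun w => clamp_tau (t w)).
Proof.
by apply: measurable_fun_sqrt; apply: measurable_funD => //; exact: measurable_funX.
Qed.

Let mrho : measurable_fun setT (fun w => clamp_rho (s w) (t w)).
Proof.
apply: measurable_fun_sqrt; apply: measurable_funD => //.
by apply: measurable_funD; exact: measurable_funX.
Qed.

Lemma measurable_clamp : measurable_fun setT (fun w => clamp (s w) (t w)).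
Proof.
by apply: measurable_funM; [exact: measurable_funM|exact: measurable_funV].
Qed.

Lemma measurable_clamp_ds : measurable_fun setT (fun w => clamp_ds (s w) (t w)).
Proof.
by apply: measurable_funX; apply: measurable_funM => //; exact: measurable_funV.
Qed.

Lemma measurable_clamp_dt : measurable_fun setT (fun w => clamp_dt (s w) (t w)).
Proof.
apply: measurable_funM; last apply: measurable_funX.
  by apply: measurable_funM => //; exact: measurable_funV.
by apply: measurable_funM => //; exact: measurable_funV.
Qed.

End measurability.

End soft_clamp.

(** * Real-valued expectations *)

Section real_expectation.
Context d (T : measurableType d) (R : realType) (P : probability T R).
Local Notation E := (Rintegral P setT).
Local Notation intg Z := (P.-integrable setT (EFin \o Z)).
Implicit Types Z : T -> R.

Lemma intg_le Z (Y : T -> R) : measurable_fun setT Z ->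
  (forall w, `|Z w| <= Y w) -> intg Y -> intg Z.
Proof.
move=> mZ ZY iY; apply: (le_integrable measurableT _ _ iY).
  exact/measurable_EFinP.
move=> w _ /=; rewrite lee_fin (le_trans (ZY w))//; exact: ler_norm.
Qed.

Lemma intg_cst (k : R) : intg (fun=> k).
Proof. exact: finite_measure_integrable_cst. Qed.

Lemma intg_bounded Z k : measurable_fun setT Z ->
  (forall w, `|Z w| <= k) -> intg Z.
Proof. by move=> mZ Zk; apply: (intg_le mZ Zk); exact: intg_cst. Qed.

Lemma intgD Z1 Z2 : intg Z1 -> intg Z2 -> intg (fun w => Z1 w + Z2 w).
Proof.
move=> i1 i2; rewrite (_ : _ \o _ = (EFin \o Z1) \+ (EFin \o Z2))%E//.
exact: integrableD.
Qed.

Lemma intgZl k Z : intg Z -> intg (fun w => k * Z w).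
Proof.
move=> iZ; rewrite (_ : _ \o _ = (fun w => k%:E * (EFin \o Z) w))%E//.
exact: integrableZl.
Qed.

Lemma intg_sum (I : Type) (s : seq I) (Q : pred I) (F : I -> T -> R) :
  (forall i, Q i -> intg (F i)) -> intg (fun w => \sum_(i <- s | Q i) F i w).
Proof.
move=> iF; elim: s => [|i s IHs].
  by rewrite (_ : (fun w => _) = (fun=> 0)); [exact: intg_cst|apply/funext => w; rewrite big_nil].
have [Qi|Qi] := boolP (Q i).
  rewrite (_ : (fun w => _) = (fun w => F i w + \sum_(j <- s | Q j) F j w)).
    by apply: intgD => //; exact: iF.
  by apply/funext => w; rewrite big_cons Qi.
rewrite (_ : (fun w => _) = (fun w => \sum_(j <- s | Q j) F j w))//.
by apply/funext => w; rewrite big_cons (negbTE Qi).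
Qed.

Lemma meanD Z1 Z2 : intg Z1 -> intg Z2 ->
  E (fun w => Z1 w + Z2 w) = E Z1 + E Z2.
Proof. by move=> i1 i2; rewrite -RintegralD. Qed.

Lemma meanZl k Z : intg Z -> E (fun w => k * Z w) = k * E Z.
Proof. by move=> iZ; rewrite -RintegralZl. Qed.

Lemma mean_cst k : E (fun=> k) = k.
Proof. by rewrite Rintegral_cst//= probability_setT mulr1. Qed.

Lemma mean_sum (I : Type) (s : seq I) (Q : pred I) (F : I -> T -> R) :
  (forall i, Q i -> intg (F i)) ->
  E (fun w => \sum_(i <- s | Q i) F i w) = \sum_(i <- s | Q i) E (F i).
Proof.
move=> iF; elim: s => [|i s IHs].
  rewrite big_nil -[RHS](mean_cst 0); congr (E _).
  by apply/funext => w; rewrite big_nil.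
rewrite big_cons -IHs; case: ifPn => Qi.
  rewrite -meanD; [|exact: iF|exact: intg_sum].
  by congr (E _); apply/funext => w; rewrite big_cons Qi.
by congr (E _); apply/funext => w; rewrite big_cons (negbTE Qi).
Qed.

Lemma mean_le Z1 Z2 : intg Z1 -> intg Z2 -> (forall w, Z1 w <= Z2 w) ->
  E Z1 <= E Z2.
Proof. by move=> i1 i2 le; apply: le_Rintegral. Qed.

Lemma intg_indic (A : set T) : measurable A -> intg (\1_A : T -> R).
Proof. by move=> mA; apply: integrable_indic. Qed.

Lemma mean_indic (A : set T) : measurable A -> (E \1_A)%:E = P A.
Proof.
move=> mA; rewrite /Rintegral integral_indic// setIT fineK//.
exact: fin_num_measure.
Qed.

Lemma intg_sqr_mul Z1 Z2 : measurable_fun setT Z1 -> measurable_fun setT Z2 ->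
  intg (fun w => Z1 w ^+ 2) -> intg (fun w => Z2 w ^+ 2) ->
  intg (fun w => Z1 w * Z2 w).
Proof.
move=> m1 m2 i1 i2.
apply: (@intg_le _ (fun w => Z1 w ^+ 2 + Z2 w ^+ 2)).
- exact: measurable_funM.
- move=> w; rewrite normrM -(real_normK (num_real (Z1 w))) -(real_normK (num_real (Z2 w))).
  have := normr_ge0 (Z1 w); have := normr_ge0 (Z2 w); nra.
- exact: intgD.
Qed.

Lemma intg_sqr Z : measurable_fun setT Z -> intg (fun w => Z w ^+ 2) -> intg Z.
Proof.
move=> mZ iZ; apply: (@intg_le _ (fun w => 1 + Z w ^+ 2)) => //.
  move=> w; rewrite -(real_normK (num_real (Z w))).
  by have := sqr_ge0 (`|Z w| - 1); have := normr_ge0 (Z w); nra.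
by apply: intgD => //; exact: intg_cst.
Qed.

(** The Cauchy-Schwarz inequality, with the optimal parameter k left open. *)
Lemma mean_mul_le (k : R) Z1 Z2 : 0 < k ->
  measurable_fun setT Z1 -> measurable_fun setT Z2 ->
  intg (fun w => Z1 w ^+ 2) -> intg (fun w => Z2 w ^+ 2) ->
  E (fun w => Z1 w * Z2 w) <=
    (k * E (fun w => Z1 w ^+ 2) + k^-1 * E (fun w => Z2 w ^+ 2)) / 2.
Proof.
move=> k0 m1 m2 i1 i2.
rewrite mulrC -!meanZl// -meanD; [|exact: intgZl..].
rewrite -meanZl; last by apply: intgD; exact: intgZl.
apply: mean_le.
- exact: intg_sqr_mul.
- by apply: intgZl; apply: intgD; exact: intgZl.
move=> w; rewrite ler_pdivlMl//.
have : 0 <= k * (Z1 w - k^-1 * Z2 w) ^+ 2 by rewrite mulr_ge0 ?(ltW k0)// sqr_ge0.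
have -> : k * (Z1 w - k^-1 * Z2 w) ^+ 2 =
    k * Z1 w ^+ 2 + k^-1 * Z2 w ^+ 2 - 2 * (Z1 w * Z2 w) by field; rewrite gt_eqF.
by rewrite subr_ge0.
Qed.

End real_expectation.

(** * Sums of independent coordinates *)

Section independent_sums.
Context (R : realType) d (T : measurableType d) (P : probability T R) (n : nat).
Variable X : 'I_n -> {RV P >-> R}.
Hypothesis indX : mutually_independent X.
Local Notation E := (Rintegral P setT).
Local Notation intg Z := (P.-integrable setT (EFin \o Z)).

Lemma indep_others_product (i : 'I_n) (phi : R -> R) (Z : others X i -> R) :
  measurable_fun setT phi -> measurable_fun setT Z ->
  intg (fun w => phi (X i w)) -> intg (Z : T -> R) ->
  intg (fun w => phi (X i w) * Z w) /\
  E (fun w => phi (X i w) * Z w) = E (fun w => phi (X i w)) * E Z.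
Proof.
move=> mphi mZ iphi iZ.
exact: (@expectation_indep_product _ _ T (others X i) R P (X i)
  [the {mfun T >-> others X i} of to_others X i]
  (fun A B => @indep_others R d T P n X i indX A B) phi Z).
Qed.

Lemma measurable_others_sum (i : 'I_n) (Q : pred 'I_n) (F : 'I_n -> R -> R) :
  (forall j, measurable_fun setT (F j)) -> (forall j, Q j -> j != i) ->
  measurable_fun [set: others X i] (fun w => \sum_(j < n | Q j) F j (X j w)).
Proof.
move=> mF Qi; rewrite (_ : (fun w => _) =
    (fun w => \sum_(j <- index_enum 'I_n) if Q j then F j (X j w) else 0)); last first.
  by apply/funext => w; rewrite big_mkcond.
apply: measurable_sum => j; case Qj : (Q j) => //.
apply: (measurableT_comp (mF j)); apply: coord_others_measurable; exact: Qi.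
Qed.

Section second_moment.
Variables (phi : 'I_n -> R -> R) (v : R) (c : 'I_n -> R) (Q : pred 'I_n).
Hypotheses (mphi : forall i, measurable_fun setT (phi i))
  (iphi : forall i, intg (fun w => phi i (X i w) ^+ 2))
  (phi0 : forall i, E (fun w => phi i (X i w)) = 0)
  (phiv : forall i, E (fun w => phi i (X i w) ^+ 2) <= v).

Let mphiX i : measurable_fun setT (fun w => phi i (X i w)).
Proof. exact: measurableT_comp. Qed.

Lemma measurable_coord_sum :
  measurable_fun setT (fun w => \sum_(i < n | Q i) c i * phi i (X i w)).
Proof.
rewrite (_ : (fun w => _) = (fun w =>
    \sum_(i <- index_enum 'I_n) if Q i then c i * phi i (X i w) else 0)); last first.
  by apply/funext => w; rewrite big_mkcond.
by apply: measurable_sum => j; case Qj : (Q j) => //; exact: measurable_funM.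
Qed.

(** Independent centred variables are orthogonal. *)
Lemma second_moment_sum :
  intg (fun w => (\sum_(i < n | Q i) c i * phi i (X i w)) ^+ 2) /\
  E (fun w => (\sum_(i < n | Q i) c i * phi i (X i w)) ^+ 2) <=
    v * \sum_(i < n | Q i) c i ^+ 2.
Proof.
have ij i j : intg (fun w => phi i (X i w) * phi j (X j w)).
  exact: intg_sqr_mul.
have E0 i j : j != i -> E (fun w => phi i (X i w) * phi j (X j w)) = 0.
  move=> ji.
  have mj : measurable_fun [set: others X i] (fun w => phi j (X j w)).
    by apply: measurableT_comp => //; exact: coord_others_measurable.
  have iX k : intg (fun w => phi k (X k w)) by exact: intg_sqr.
  have [_ ->] := indep_others_product (mphi i) mj (iX i) (iX j).
  by rewrite phi0 mul0r.
have -> : (fun w => (\sum_(i < n | Q i) c i * phi i (X i w)) ^+ 2) =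
    (fun w => \sum_(i < n | Q i) \sum_(j < n | Q j)
       (c i * c j) * (phi i (X i w) * phi j (X j w))).
  apply/funext => w; rewrite expr2 big_distrlr /=.
  by apply: eq_bigr => i _; apply: eq_bigr => j _; ring.
split.
  by apply: intg_sum => i _; apply: intg_sum => j _; exact: intgZl.
rewrite mean_sum => [|i _]; last first.
  by apply: intg_sum => j _; exact: intgZl.
rewrite mulr_sumr; apply: ler_sum => i Qi.
rewrite mean_sum => [|j _]; last exact: intgZl.
rewrite (bigD1 i)//= big1 ?addr0 => [|j /andP[_ ji]]; last first.
  by rewrite meanZl// E0// mulr0.
rewrite meanZl// -expr2 mulrC ler_wpM2r ?sqr_ge0//.
by rewrite (le_trans _ (phiv i)).
Qed.

End second_moment.

End independent_sums.

(** * Comparison of two linear forms *)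

(** [Ch] and [Cq] bound h and q / M, and [Cx] bounds the variance times M^2.
    Keeping them symbolic keeps the numerals out of the arithmetic. *)
Definition comparison_constant (R : realType) (Ch Cq Cx : R) : R :=
  let K := 16 * (Ch + 1) ^+ 2 in
  6 * ((Cx + 1 + Cq ^+ 2) / 2 + Ch) + (2 * (Cx + K) + 4 * K).

Lemma comparison_constant_gt0 (R : realType) (Ch Cq Cx : R) :
  0 <= Ch -> 0 <= Cq -> 0 <= Cx -> 0 < comparison_constant Ch Cq Cx.
Proof.
move=> h1 h2 h3; rewrite /comparison_constant.
have := sqr_ge0 (Ch + 1); have := sqr_ge0 Cq; lra.
Qed.

Section two_linear_forms.
Context (R : realType) d (T : measurableType d) (P : probability T R) (n : nat).
Variable X : 'I_n -> {RV P >-> R}.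
Hypothesis indX : mutually_independent X.
Local Notation E := (Rintegral P setT).
Local Notation intg Z := (P.-integrable setT (EFin \o Z)).

Variables (M Ch Cq Cx : R) (h q : 'I_n -> R -> R).
Hypotheses (M0 : 0 < M) (Ch0 : 0 <= Ch) (Cq0 : 0 <= Cq) (Cx0 : 0 <= Cx)
  (mh : forall i, measurable_fun setT (h i))
  (mq : forall i, measurable_fun setT (q i))
  (h_bound : forall i x, 0 <= h i x <= Ch)
  (q_bound : forall i x, `|q i x| <= Cq * M)
  (h_mean : forall i, (\int[distribution P (X i)]_x (h i x)%:E = 1)%E)
  (hq_parts : forall i (G G' : R -> R), (forall x : R, is_derive x 1 G (G' x)) ->
    continuous G' ->
    (\int[distribution P (X i)]_x (h i x * G' x)%:E =
     \int[distribution P (X i)]_x (q i x * G x)%:E)%E)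
  (X_mean : forall i, (\int[distribution P (X i)]_x x%:E = 0)%E)
  (X_var : forall i,
    (\int[distribution P (X i)]_x (x ^+ 2)%:E <= (Cx / M ^+ 2)%:E)%E).

Let mX i : measurable_fun setT (X i : T -> R).
Proof. exact: measurable_funP. Qed.

Let mhX i : measurable_fun setT (fun w => h i (X i w)).
Proof. exact: measurableT_comp. Qed.

Let mqX i : measurable_fun setT (fun w => q i (X i w)).
Proof. exact: measurableT_comp. Qed.

Let ihX i : intg (fun w => h i (X i w)).
Proof.
by apply: (@intg_bounded _ _ _ _ _ Ch) => // w; have /andP[? ?] := h_bound i (X i w); rewrite ger0_norm.
Qed.

Let iqX i : intg (fun w => q i (X i w)).
Proof. by apply: (@intg_bounded _ _ _ _ _ (Cq * M)). Qed.

Let mean_law i (phi : R -> R) : measurable_fun setT phi ->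
  intg (fun w => phi (X i w)) ->
  E (fun w => phi (X i w)) = fine (\int[distribution P (X i)]_x (phi x)%:E)%E.
Proof.
move=> mphi iphi; rewrite /Rintegral integral_distribution//.
exact/measurable_EFinP.
Qed.

Let Eh i : E (fun w => h i (X i w)) = 1.
Proof. by rewrite mean_law// h_mean. Qed.

Let Eq i : E (fun w => q i (X i w)) = 0.
Proof.
rewrite mean_law//.
have d1 (x : R) : is_derive x 1 (fun=> 1 : R) (0 : R) by exact: is_derive_cst.
have := hq_parts i d1 (fun x => cvg_cst _).
under eq_integral do rewrite mulr0; rewrite integral0.
by under eq_integral do rewrite mulr1; move=> <-.
Qed.

Let iX2 i : intg (fun w => X i w ^+ 2).
Proof.
apply/integrableP; split.
  by apply/measurable_EFinP; exact: measurable_funX.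
rewrite (eq_integral (fun w => ((fun x : R => (x ^+ 2)%:E) \o X i) w)); last first.
  by move=> w _ /=; rewrite ger0_norm// sqr_ge0.
rewrite -ge0_integral_distribution//.
- by apply: le_lt_trans (X_var i) _; rewrite ltry.
- by apply/measurable_EFinP; exact: exprn_measurable.
- by move=> x; rewrite lee_fin sqr_ge0.
Qed.

Let iX i : intg (X i : T -> R).
Proof. by apply: intg_sqr. Qed.

Let EX i : E (X i : T -> R) = 0.
Proof. by rewrite (@mean_law i id)//= ?X_mean. Qed.

Let EX2 i : E (fun w => X i w ^+ 2) <= Cx / M ^+ 2.
Proof.
rewrite (@mean_law i (fun x => x ^+ 2))//.
rewrite -lee_fin fineK ?X_var// ge0_fin_numE.
  by apply: le_lt_trans (X_var i) _; rewrite ltry.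
by apply: integral_ge0 => x _; rewrite lee_fin sqr_ge0.
Qed.

Variables (a b : 'I_n -> R).
Let S (w : T) : R := \sum_(j < n) a j * X j w.
Let V (w : T) : R := \sum_(j < n) b j * X j w.

Let mS : measurable_fun setT S.
Proof. exact: (@measurable_coord_sum _ _ _ _ _ X (fun=> id) a xpredT). Qed.
Let mV : measurable_fun setT V.
Proof. exact: (@measurable_coord_sum _ _ _ _ _ X (fun=> id) b xpredT). Qed.

Lemma linear_form_sqr (Q : pred 'I_n) :
  intg (fun w => (\sum_(j < n | Q j) b j * X j w) ^+ 2) /\
  E (fun w => (\sum_(j < n | Q j) b j * X j w) ^+ 2) <=
    Cx / M ^+ 2 * \sum_(j < n | Q j) b j ^+ 2.
Proof. exact: (@second_moment_sum _ _ _ _ _ X indX (fun=> id)). Qed.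

Section parts.
Variable eta : R.
Hypothesis eta0 : 0 < eta.
Local Notation F w := (clamp eta (S w) (V w)).
Local Notation FS w := (clamp_ds eta (S w) (V w)).
Local Notation FV w := (clamp_dt eta (S w) (V w)).

Let F_intg : intg (fun w => F w).
Proof.
have [iV _] := linear_form_sqr xpredT.
apply: (@intg_le _ _ _ _ _ (fun w => V w ^+ 2 + (eta ^+ 2 + 1))).
- exact: measurable_clamp.
- move=> w; have := clamp_sqr_le eta0 (S w) (V w).
  rewrite -(real_normK (num_real (clamp _ _ _))).
  by have := sqr_ge0 (`|F w| - 1); have := normr_ge0 (F w); nra.
- by apply: intgD => //; exact: intg_cst.
Qed.

(** With the other coordinates frozen, this is the integration by parts for the
    law of X_i, applied to F along a line of direction (a_i, b_i). *)
Lemma coordinate_parts (i : 'I_n) :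
  E (fun w => h i (X i w) * (a i * FS w + b i * FV w)) =
  E (fun w => q i (X i w) * F w).
Proof.
pose Si (w : others X i) : R := \sum_(j < n | j != i) a j * X j w.
pose Vi (w : others X i) : R := \sum_(j < n | j != i) b j * X j w.
have mSi : measurable_fun setT Si.
  by apply: (@measurable_others_sum _ _ _ _ _ X i (fun j => j != i)
    (fun j x => a j * x)) => // j; exact: measurable_funM.
have mVi : measurable_fun setT Vi.
  by apply: (@measurable_others_sum _ _ _ _ _ X i (fun j => j != i)
    (fun j x => b j * x)) => // j; exact: measurable_funM.
have SE w : S w = a i * X i w + Si w by rewrite /S (bigD1 i).
have VE w : V w = b i * X i w + Vi w by rewrite /V (bigD1 i).
have ml (c : R) (Z : others X i -> R) : measurable_fun setT Z ->
    measurable_fun setT (fun z : R * others X i => c * z.1 + Z z.2).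
  by move=> mZ; apply: measurable_funD; [exact: measurable_funM|exact: measurableT_comp].
pose s (z : R * others X i) := a i * z.1 + Si z.2.
pose t (z : R * others X i) := b i * z.1 + Vi z.2.
have ms : measurable_fun setT s by exact: ml.
have mt : measurable_fun setT t by exact: ml.
pose G1 z := h i z.1 * (a i * clamp_ds eta (s z) (t z) + b i * clamp_dt eta (s z) (t z)).
pose G2 z := q i z.1 * clamp eta (s z) (t z).
have mG1 : measurable_fun setT G1.
  apply: measurable_funM; first exact: measurableT_comp.
  apply: measurable_funD; apply: measurable_funM => //.
    exact: measurable_clamp_ds.
  exact: measurable_clamp_dt.
have mG2 : measurable_fun setT G2.
  by apply: measurable_funM; [exact: measurableT_comp|exact: measurable_clamp].
have dis := @disintegration _ _ T (others X i) R P (X i)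
  [the {mfun T >-> others X i} of to_others X i]
  (fun A B => @indep_others R d T P n X i indX A B).
have iG1 : intg (fun w => h i (X i w) * (a i * FS w + b i * FV w)).
  apply: (@intg_bounded _ _ _ _ _ (Ch * (`|a i| + `|b i|))).
    apply: measurable_funM => //; apply: measurable_funD; apply: measurable_funM => //.
      exact: measurable_clamp_ds.
    exact: measurable_clamp_dt.
  move=> w; have /andP[h0 h1] := h_bound i (X i w).
  rewrite normrM ler_pM// ?(ger0_norm h0)//.
  apply: (le_trans (ler_normD _ _)); rewrite (normrM (a i)) (normrM (b i)); apply: lerD; apply: ler_piMr => //.
    by rewrite ger0_norm; [exact: clamp_ds_le1|exact: clamp_ds_ge0].
  exact: clamp_dt_le1.
have iG2 : intg (fun w => q i (X i w) * F w).
  apply: (@intg_le _ _ _ _ _ (fun w => (Cq * M) * `|F w|)).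
  - by apply: measurable_funM => //; exact: measurable_clamp.
  - by move=> w; rewrite normrM ler_wpM2r.
  - by apply: intgZl; exact: integrable_norm.
rewrite /Rintegral; congr fine.
transitivity (\int[P]_w (G1 (X i w, w))%:E)%E.
  by apply: eq_integral => w _; rewrite /G1 /s /t /= -SE -VE.
transitivity (\int[P]_w (G2 (X i w, w))%:E)%E; last first.
  by apply: eq_integral => w _; rewrite /G2 /s /t /= -SE -VE.
rewrite (dis _ mG1); last first.
  by move: iG1; apply: eq_integrable => // w _; rewrite /G1 /s /t /= -SE -VE.
rewrite (dis _ mG2); last first.
  by move: iG2; apply: eq_integrable => // w _; rewrite /G2 /s /t /= -SE -VE.
apply: eq_integral => w _.
exact: (hq_parts i (fun x => is_derive_clamp_line eta0 (a i) (Si w) (b i) (Vi w) x)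
  (@continuous_clamp_line_derive _ eta eta0 (a i) (Si w) (b i) (Vi w))).
Qed.

Variables (Q : pred 'I_n) (N B : R).
Hypotheses (N0 : 0 < N) (B0 : 0 < B) (aN : \sum_(i < n) a i ^+ 2 = N ^+ 2)
  (bB : \sum_(i < n) b i ^+ 2 <= B ^+ 2).

Let abNB : \sum_(i < n | Q i) `|a i * b i| <= N * B.
Proof.
apply: (@le_trans _ _ (\sum_(i < n) (B / N * a i ^+ 2 + N / B * b i ^+ 2) / 2)).
  rewrite [leRHS](bigID Q) /= -[leLHS]addr0 lerD//; last first.
    apply: sumr_ge0 => i _; rewrite divr_ge0// addr_ge0// mulr_ge0 ?divr_ge0 ?sqr_ge0//; exact: ltW.
  apply: ler_sum => i _; rewrite ler_pdivlMr//.
  have : 0 <= B / N * (`|a i| - N / B * `|b i|) ^+ 2.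
    by rewrite mulr_ge0 ?sqr_ge0// divr_ge0// ltW.
  have -> : B / N * (`|a i| - N / B * `|b i|) ^+ 2 =
      B / N * `|a i| ^+ 2 + N / B * `|b i| ^+ 2 - `|a i| * `|b i| * 2.
    by field; rewrite !gt_eqF.
  by rewrite subr_ge0 !real_normK ?num_real// normrM.
rewrite -mulr_suml big_split /= -!mulr_sumr aN ler_pdivrMr//.
have : N / B * \sum_(i < n) b i ^+ 2 <= N / B * B ^+ 2.
  by rewrite ler_wpM2l// divr_ge0// ltW.
have -> : N / B * B ^+ 2 = N * B by field; rewrite gt_eqF.
have -> : B / N * N ^+ 2 = N * B by field; rewrite gt_eqF.
by move=> ?; lra.
Qed.

Let sum_sqr_le (c : 'I_n -> R) : \sum_(i < n | Q i) c i ^+ 2 <= \sum_(i < n) c i ^+ 2.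
Proof.
rewrite [leRHS](bigID Q) /= -[leLHS]addr0 lerD//.
by apply: sumr_ge0 => i _; exact: sqr_ge0.
Qed.

Hypothesis etaE : eta = B / M.

(** Summing a_i times [coordinate_parts] over i, the terms in FS add up to
    the expectation below, those in FV are at most [Ch] times the sum of the
    |a_i b_i|, and the terms in q add up to the product of F by a sum of
    orthogonal variables. *)
Lemma weighted_clamp_mean :
  intg (fun w => FS w * \sum_(i < n | Q i) a i ^+ 2 * h i (X i w)) /\
  E (fun w => FS w * \sum_(i < n | Q i) a i ^+ 2 * h i (X i w)) <=
    ((Cx + 1 + Cq ^+ 2) / 2 + Ch) * (N * B).
Proof.
have mF : measurable_fun setT (fun w => F w) by exact: measurable_clamp.
have mFS : measurable_fun setT (fun w => FS w) by exact: measurable_clamp_ds.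
have mFV : measurable_fun setT (fun w => FV w) by exact: measurable_clamp_dt.
have ihF i (G : T -> R) k : measurable_fun setT G -> (forall w, `|G w| <= k) ->
    intg (fun w => h i (X i w) * G w).
  move=> mG Gk; apply: (@intg_bounded _ _ _ _ _ (Ch * k)); first exact: measurable_funM.
  move=> w; have /andP[h0 h1] := h_bound i (X i w).
  by rewrite normrM ler_pM// ?(ger0_norm h0).
have FS1 w : `|FS w| <= 1.
  by rewrite ger0_norm; [exact: clamp_ds_le1|exact: clamp_ds_ge0].
have FV1 w : `|FV w| <= 1 by exact: clamp_dt_le1.
have i1 i : intg (fun w => h i (X i w) * (a i * FS w + b i * FV w)).
  apply: (ihF _ _ (`|a i| + `|b i|)).
    by apply: measurable_funD; apply: measurable_funM.
  move=> w; apply: (le_trans (ler_normD _ _)).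
  by rewrite (normrM (a i)) (normrM (b i)); apply: lerD; apply: ler_piMr.
have i2 i : intg (fun w => h i (X i w) * FV w) by exact: ihF FV1.
have iqF i : intg (fun w => q i (X i w) * F w).
  apply: (@intg_le _ _ _ _ _ (fun w => (Cq * M) * `|F w|)).
  - exact: measurable_funM.
  - by move=> w; rewrite normrM ler_wpM2r.
  - by apply: intgZl; exact: integrable_norm.
have i3 : intg (fun w => \sum_(i < n | Q i)
    (a i * (h i (X i w) * (a i * FS w + b i * FV w)) +
     - (a i * b i) * (h i (X i w) * FV w))).
  by apply: intg_sum => i _; apply: intgD; exact: intgZl.
have -> : (fun w => FS w * \sum_(i < n | Q i) a i ^+ 2 * h i (X i w)) =
  (fun w => \sum_(i < n | Q i)
    (a i * (h i (X i w) * (a i * FS w + b i * FV w)) +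
     - (a i * b i) * (h i (X i w) * FV w))).
  by apply/funext => w; rewrite mulr_sumr; apply: eq_bigr => i _; ring.
split => //.
rewrite mean_sum => [|i _]; last by apply: intgD; exact: intgZl.
have -> : \sum_(i < n | Q i) E (fun w =>
    a i * (h i (X i w) * (a i * FS w + b i * FV w)) +
     - (a i * b i) * (h i (X i w) * FV w)) =
  E (fun w => F w * \sum_(i < n | Q i) a i * q i (X i w)) +
  \sum_(i < n | Q i) - (a i * b i) * E (fun w => h i (X i w) * FV w).
  rewrite (_ : (fun w => F w * _) =
      (fun w => \sum_(i < n | Q i) a i * (q i (X i w) * F w))); last first.
    by apply/funext => w; rewrite mulr_sumr; apply: eq_bigr => i _; ring.
  rewrite mean_sum => [|i _]; last exact: intgZl.
  rewrite -big_split /=; apply: eq_bigr => i _.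
  by rewrite meanD ?meanZl// ?coordinate_parts//; exact: intgZl.
have [iV EV] := linear_form_sqr xpredT.
have q2 i w : `|q i (X i w) ^+ 2| <= (Cq * M) ^+ 2.
  by rewrite normrX lerXn2r ?nnegrE// mulr_ge0// ltW.
have iq2 i : intg (fun w => q i (X i w) ^+ 2).
  by apply: (@intg_bounded _ _ _ _ _ ((Cq * M) ^+ 2)) => //; exact: measurable_funX.
have Eq2 i : E (fun w => q i (X i w) ^+ 2) <= (Cq * M) ^+ 2.
  rewrite -[leRHS](mean_cst P); apply: mean_le => //; first exact: intg_cst.
  by move=> w; apply: le_trans (q2 i w); exact: ler_norm.
have [iQ EQ] := @second_moment_sum _ _ _ P _ X indX q _ a Q mq iq2 Eq Eq2.
have mQ := @measurable_coord_sum _ _ _ P _ X q a Q mq.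
have B2M : 0 < B ^+ 2 / M ^+ 2 by rewrite divr_gt0 ?exprn_gt0.
have iF2 : intg (fun w => F w ^+ 2).
  apply: (@intg_le _ _ _ _ _ (fun w => V w ^+ 2 + eta ^+ 2)).
  - exact: measurable_funX.
  - by move=> w; rewrite ger0_norm ?sqr_ge0//; exact: clamp_sqr_le.
  - by apply: intgD => //; exact: intg_cst.
have EF : E (fun w => F w ^+ 2) <= (Cx + 1) * (B ^+ 2 / M ^+ 2).
  apply: (@le_trans _ _ (E (fun w => V w ^+ 2 + eta ^+ 2))).
    apply: mean_le => //; first by apply: intgD => //; exact: intg_cst.
    by move=> w; exact: clamp_sqr_le.
  rewrite meanD//; last exact: intg_cst.
  rewrite mean_cst mulrDl mul1r lerD//; last by rewrite etaE exprMn exprVn.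
  apply: (le_trans EV).
  have -> : Cx * (B ^+ 2 / M ^+ 2) = Cx / M ^+ 2 * B ^+ 2 by ring.
  by rewrite ler_wpM2l// divr_ge0// sqr_ge0.
(* This k balances the two second moments, of order B^2/M^2 and M^2 N^2. *)
have k0 : 0 < M ^+ 2 * N / B by rewrite divr_gt0// mulr_gt0// exprn_gt0.
have := mean_mul_le k0 mF mQ iF2 iQ.
have E1 : M ^+ 2 * N / B * E (fun w => F w ^+ 2) <= (Cx + 1) * (N * B).
  have -> : (Cx + 1) * (N * B) = M ^+ 2 * N / B * ((Cx + 1) * (B ^+ 2 / M ^+ 2)).
    by field; rewrite !gt_eqF.
  by rewrite ler_wpM2l// ltW.
have E2 : (M ^+ 2 * N / B)^-1 *
    E (fun w => (\sum_(i < n | Q i) a i * q i (X i w)) ^+ 2) <= Cq ^+ 2 * (N * B).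
  have -> : Cq ^+ 2 * (N * B) = (M ^+ 2 * N / B)^-1 * ((Cq * M) ^+ 2 * N ^+ 2).
    by field; rewrite !gt_eqF.
  rewrite ler_wpM2l ?invr_ge0 ?(ltW k0)//; apply: (le_trans EQ).
  by rewrite ler_wpM2l ?sqr_ge0// -aN.
have E3 : \sum_(i < n | Q i) - (a i * b i) * E (fun w => h i (X i w) * FV w) <=
    Ch * (N * B).
  apply: (@le_trans _ _ (\sum_(i < n | Q i) `|a i * b i| * Ch)); last first.
    by rewrite -mulr_suml mulrC ler_wpM2l.
  apply: ler_sum => i _; apply: (le_trans (ler_norm _)).
  rewrite normrM normrN ler_wpM2l//.
  apply: (le_trans (le_normr_Rintegral measurableT (i2 i))).
  rewrite -[leRHS](mean_cst P); apply: mean_le.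
  - exact: integrable_norm.
  - exact: intg_cst.
  - move=> w; have /andP[h0 h1] := h_bound i (X i w).
    by rewrite normrM (ger0_norm h0) -[leRHS]mulr1 ler_pM.
move=> E4; rewrite mulrDl; apply: lerD => //.
apply: (le_trans E4); lra.
Qed.

End parts.

Let H (Q : pred 'I_n) (w : T) : R := \sum_(i < n | Q i) a i ^+ 2 * h i (X i w).
Let mH Q : measurable_fun setT (H Q).
Proof. exact: (@measurable_coord_sum _ _ _ _ _ X h (fun i => a i ^+ 2) Q). Qed.

Let A : set T := [set w | `|S w| <= `|V w|].
Let mA : measurable A.
Proof.
rewrite /A -[X in measurable X]setTI.
by apply: measurable_fun_ler => //; apply: measurableT_comp.
Qed.

Variables (N B : R).
Hypotheses (N0 : 0 < N) (B0 : 0 < B) (aN : \sum_(i < n) a i ^+ 2 = N ^+ 2)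
  (bB : \sum_(i < n) b i ^+ 2 <= B ^+ 2).

Let D (Q : pred 'I_n) : set T := [set w | H Q w < N ^+ 2 / 2].
Let mD Q : measurable (D Q).
Proof.
rewrite /D -[X in measurable X]setTI.
exact: measurable_fun_ltr.
Qed.

Let H_ge0 Q w : 0 <= H Q w.
Proof.
apply: sumr_ge0 => i _; apply: mulr_ge0; first exact: sqr_ge0.
by have /andP[] := h_bound i (X i w).
Qed.

(** On the event, clamp_ds >= 1/3 and H >= N^2/2, so that 6/N^2 times
    clamp_ds H is at least its indicator. *)
Lemma large_weight_event (Q : pred 'I_n) :
  (P (A `\` D Q) <= (6 * ((Cx + 1 + Cq ^+ 2) / 2 + Ch) * (B / N))%:E)%E.
Proof.
have eta0 : 0 < B / M by rewrite divr_gt0.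
have mAD : measurable (A `\` D Q) by exact: measurableD.
have [iW EW] := weighted_clamp_mean eta0 Q N0 B0 aN bB (erefl _).
rewrite -mean_indic// lee_fin.
apply: (@le_trans _ _ (E (fun w => 6 / N ^+ 2 * (clamp_ds (B / M) (S w) (V w) * H Q w)))).
  apply: mean_le; [exact: intg_indic|exact: intgZl|].
  move=> w; have N2 : 0 < N ^+ 2 by rewrite exprn_gt0.
  have W0 : 0 <= clamp_ds (B / M) (S w) (V w) * H Q w.
    by rewrite mulr_ge0//; exact: clamp_ds_ge0.
  rewrite indicE; have [|_] := boolP (w \in _); last first.
    by rewrite mulr_ge0// divr_ge0// ltW.
  rewrite inE => -[Aw /negP]; rewrite -leNgt => Hw.
  have := clamp_ds_lower eta0 Aw => ds.
  rewrite mulrAC ler_pdivlMr// mul1r.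
  have : 1 / 3 * H Q w <= clamp_ds (B / M) (S w) (V w) * H Q w by rewrite ler_wpM2r.
  by move=> ?; lra.
rewrite meanZl//.
apply: (@le_trans _ _ (6 / N ^+ 2 * (((Cx + 1 + Cq ^+ 2) / 2 + Ch) * (N * B)))).
  by rewrite ler_wpM2l// divr_ge0// sqr_ge0.
by rewrite le_eqVlt; apply/orP; left; apply/eqP; field; rewrite gt_eqF.
Qed.

Variable i0 : 'I_n.
Hypothesis a_max : forall i, a i ^+ 2 <= a i0 ^+ 2.
Let Q0 : pred 'I_n := fun i => i != i0.
Let K := 16 * (Ch + 1) ^+ 2.
Let K0 : 0 <= K. Proof. by rewrite mulr_ge0// sqr_ge0. Qed.

(** The weight without the index i0 has mean N^2 - a_i0^2 and variance of order
    the sum of the a_i^4, at most a_i0^2 N^2.  If a_i0^2 <= N^2/4 this is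
    Chebyshev's inequality; otherwise the bound exceeds 1. *)
Lemma small_weight_probability : (P (D Q0) <= (K * (a i0 ^+ 2 / N ^+ 2))%:E)%E.
Proof.
have N2 : 0 < N ^+ 2 by rewrite exprn_gt0.
have Ch1 : 1 <= (Ch + 1) ^+ 2 by rewrite expr_ge1// ?addr_ge0// lerDr.
have [aN4|aN4] := leP (a i0 ^+ 2) (N ^+ 2 / 4); last first.
  apply: (le_trans (probability_le1 _ (mD _))); rewrite lee_fin.
  have h1 : 1 / 4 <= a i0 ^+ 2 / N ^+ 2 by rewrite ler_pdivlMr//; lra.
  have : K * (1 / 4) <= K * (a i0 ^+ 2 / N ^+ 2) by rewrite ler_wpM2l.
  by rewrite /K; lra.
have mh1 i : measurable_fun setT (fun x => h i x - 1).
  by apply: measurable_funB.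
have h1 i w : `|(h i (X i w) - 1) ^+ 2| <= (Ch + 1) ^+ 2.
  rewrite normrX lerXn2r ?nnegrE ?addr_ge0//.
  have /andP[h0 h1] := h_bound i (X i w).
  by rewrite ler_norml; apply/andP; split; lra.
have ih2 i : intg (fun w => (h i (X i w) - 1) ^+ 2).
  apply: (@intg_bounded _ _ _ _ _ ((Ch + 1) ^+ 2)) => //.
  by apply: measurable_funX; exact: measurable_funB.
have Eh1 i : E (fun w => h i (X i w) - 1) = 0.
  by rewrite meanD ?mean_cst ?Eh ?subrr//; exact: intg_cst.
have Eh2 i : E (fun w => (h i (X i w) - 1) ^+ 2) <= (Ch + 1) ^+ 2.
  rewrite -[leRHS](mean_cst P); apply: mean_le => //; first exact: intg_cst.
  by move=> w; apply: le_trans (h1 i w); exact: ler_norm.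
have [iW EW] := @second_moment_sum _ _ _ P _ X indX (fun i x => h i x - 1) _
  (fun i => a i ^+ 2) Q0 mh1 ih2 Eh1 Eh2.
have sumQ0 : \sum_(i < n | Q0 i) a i ^+ 2 = N ^+ 2 - a i0 ^+ 2.
  by rewrite -aN [in RHS](bigD1 i0)//= addrAC subrr add0r.
rewrite -mean_indic// lee_fin.
apply: (@le_trans _ _ (E (fun w => 16 / N ^+ 4 *
    (\sum_(i < n | Q0 i) a i ^+ 2 * (h i (X i w) - 1)) ^+ 2))).
  apply: mean_le; [exact: intg_indic|exact: intgZl|].
  move=> w; rewrite indicE; have [|_] := boolP (w \in _); last first.
    by rewrite mulr_ge0 ?sqr_ge0// divr_ge0// exprn_ge0// ltW.
  rewrite inE /D /= => Hw.
  have -> : \sum_(i < n | Q0 i) a i ^+ 2 * (h i (X i w) - 1) =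
      H Q0 w - (N ^+ 2 - a i0 ^+ 2).
    by rewrite -sumQ0 /H -sumrB; apply: eq_bigr => i _; rewrite mulrBr mulr1.
  rewrite mulrAC ler_pdivlMr ?exprn_gt0// mul1r.
  have : (N ^+ 2 / 4) ^+ 2 <= (H Q0 w - (N ^+ 2 - a i0 ^+ 2)) ^+ 2.
    have p1 : 0 <= N ^+ 2 / 4 by lra.
    have p2 : N ^+ 2 / 4 <= - (H Q0 w - (N ^+ 2 - a i0 ^+ 2)) by lra.
    by rewrite -[leRHS]sqrrN lerXn2r ?nnegrE//; exact: le_trans p2.
  by rewrite -[4%N]/(2 * 2)%N exprM; move=> ?; lra.
rewrite meanZl//.
have a4 : \sum_(i < n | Q0 i) (a i ^+ 2) ^+ 2 <= a i0 ^+ 2 * N ^+ 2.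
  apply: (@le_trans _ _ (\sum_(i < n) a i0 ^+ 2 * a i ^+ 2)).
    rewrite [leRHS](bigID Q0) /= -[leLHS]addr0 lerD//; last first.
      by apply: sumr_ge0 => i _; apply: mulr_ge0; exact: sqr_ge0.
    by apply: ler_sum => i _; rewrite expr2 ler_wpM2r ?sqr_ge0.
  by rewrite -mulr_sumr aN.
apply: (@le_trans _ _ (16 / N ^+ 4 * ((Ch + 1) ^+ 2 * (a i0 ^+ 2 * N ^+ 2)))).
  rewrite ler_wpM2l//; first by rewrite divr_ge0// exprn_ge0// ltW.
  by apply: (le_trans EW); rewrite ler_wpM2l// sqr_ge0.
by rewrite le_eqVlt; apply/orP; left; apply/eqP; rewrite /K; field; rewrite gt_eqF.
Qed.

Hypothesis ball : forall (i : 'I_n) (a b s t : R), a != 0 -> `|b| <= `|a| / 4 ->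
  (distribution P (X i) [set x | (`|a * x + s| <= `|b * x + t|)%R] <=
   (4 * (M * `|t| + `|b|) / `|a|)%:E)%E.

(** If |b_i0| > |a_i0|/4, the probability of the small weight alone is small
    enough.  Otherwise X_i0 is integrated out first. *)
Lemma small_weight_event :
  (P (A `&` D Q0) <= ((2 * (Cx + K) + 4 * K) * (B / N))%:E)%E.
Proof.
have N2 : 0 < N ^+ 2 by rewrite exprn_gt0.
have a0 : a i0 != 0.
  apply/eqP => a0; move: N2; rewrite -aN big1 ?ltxx// => i _.
  by apply/eqP; rewrite eq_le sqr_ge0 andbT (le_trans (a_max i))// a0 expr0n.
have na0 : 0 < `|a i0| by rewrite normr_gt0.
have a0N : `|a i0| <= N.
  rewrite -(@ler_pXn2r _ 2)// ?nnegrE ?(ltW N0)// real_normK ?num_real// -aN.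
  by rewrite (bigD1 i0)//= lerDl; apply: sumr_ge0 => i _; exact: sqr_ge0.
have b0B : `|b i0| <= B.
  rewrite -(@ler_pXn2r _ 2)// ?nnegrE ?(ltW B0)// real_normK ?num_real//.
  apply: le_trans bB.
  by rewrite (bigD1 i0)//= lerDl; apply: sumr_ge0 => i _; exact: sqr_ge0.
have mAD : measurable (A `&` D Q0) by exact: measurableI.
have BN0 : 0 < B / N by rewrite divr_gt0.
have abBN : `|a i0| / N * (`|b i0| / N) <= B / N.
  rewrite -[leRHS]mul1r; apply: ler_pM; rewrite ?divr_ge0// ?(ltW N0)//.
    by rewrite ler_pdivrMr// mul1r.
  by rewrite ler_wpM2r// invr_ge0 ltW.
have [ba|ba] := leP `|b i0| (`|a i0| / 4); last first.
  apply: (@le_trans _ _ (P (D Q0))).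
    by apply: le_measure; rewrite ?inE// => w [].
  apply: (le_trans small_weight_probability); rewrite lee_fin.
  have h1 : a i0 ^+ 2 / N ^+ 2 <= 4 * (`|a i0| / N * (`|b i0| / N)).
    have -> : a i0 ^+ 2 / N ^+ 2 = `|a i0| / N * (`|a i0| / N).
      by rewrite -(real_normK (num_real (a i0))); field; rewrite gt_eqF.
    have h0 : `|a i0| / N <= 4 * (`|b i0| / N).
      by rewrite mulrA ler_wpM2r ?invr_ge0 ?(ltW N0)//; lra.
    rewrite [leRHS]mulrCA; apply: ler_wpM2l h0.
    by rewrite divr_ge0// ltW.
  have h2 : K * (a i0 ^+ 2 / N ^+ 2) <= K * (4 * (B / N)).
    by rewrite ler_wpM2l//; lra.
  have h3 : 0 <= (Cx + K) * (B / N) by rewrite mulr_ge0 ?addr_ge0// ltW.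
  by rewrite mulrDl; lra.
pose Si (w : others X i0) : R := \sum_(j < n | j != i0) a j * X j w.
pose Vi (w : others X i0) : R := \sum_(j < n | j != i0) b j * X j w.
pose Hi (w : others X i0) : R := \sum_(j < n | j != i0) a j ^+ 2 * h j (X j w).
have mSi : measurable_fun setT Si.
  by apply: (@measurable_others_sum _ _ _ _ _ X i0 (fun j => j != i0)
    (fun j x => a j * x)) => // j; exact: measurable_funM.
have mVi : measurable_fun setT Vi.
  by apply: (@measurable_others_sum _ _ _ _ _ X i0 (fun j => j != i0)
    (fun j x => b j * x)) => // j; exact: measurable_funM.
have mHi : measurable_fun setT Hi.
  by apply: (@measurable_others_sum _ _ _ _ _ X i0 (fun j => j != i0)
    (fun j x => a j ^+ 2 * h j x)) => // j; exact: measurable_funM.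
have SE w : S w = a i0 * X i0 w + Si w by rewrite /S (bigD1 i0).
have VE w : V w = b i0 * X i0 w + Vi w by rewrite /V (bigD1 i0).
have ml (c : R) (Z : others X i0 -> R) : measurable_fun setT Z ->
    measurable_fun setT (fun z : R * others X i0 => `|c * z.1 + Z z.2|).
  move=> mZ; apply: measurableT_comp => //; apply: measurable_funD.
    exact: measurable_funM.
  exact: measurableT_comp.
pose W : set (R * others X i0) :=
  [set z | `|a i0 * z.1 + Si z.2| <= `|b i0 * z.1 + Vi z.2|] `&`
  [set z | Hi z.2 < N ^+ 2 / 2].
have mW : measurable W.
  apply: measurableI; rewrite -[X in measurable X]setTI.
    by apply: measurable_fun_ler => //; exact: ml.
  by apply: measurable_fun_ltr => //; exact: measurableT_comp.
have mG : measurable_fun setT (fun z => (\1_W z)%:E : \bar R).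
  by apply/measurable_EFinP; exact: measurable_indic.
have dis := @disintegration_ge0 _ _ T (others X i0) R P (X i0)
  [the {mfun T >-> others X i0} of to_others X i0]
  (fun A B => @indep_others R d T P n X i0 indX A B) _ mG.
have PE : P (A `&` D Q0) = (\int[P]_w (\1_W (X i0 w, w))%:E)%E.
  rewrite -(setIT (A `&` D Q0)) -integral_indic//; apply: eq_integral => w _.
  rewrite !indicE; congr (_%:R%:E); congr nat_of_bool.
  by apply/idP/idP; rewrite !inE /A /D /W /= SE VE.
have G0 z : (0 <= (\1_W z)%:E :> \bar R)%E by rewrite lee_fin indicE.
rewrite PE dis//.
pose bnd w := 4 * (M * `|Vi w| + `|b i0|) / `|a i0|.
have bnd0 w : 0 <= bnd w.
  by rewrite divr_ge0// mulr_ge0// addr_ge0// mulr_ge0// ltW.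
apply: (@le_trans _ _ (\int[P]_w (bnd w * \1_(D Q0) w)%:E)%E).
  apply: ge0_le_integral => //.
  - by move=> w _; apply: integral_ge0 => x _; rewrite lee_fin indicE.
  - have mdis := @measurable_fun_fubini_tonelli_G _ _ _ (others X i0) R
      (distribution P (X i0)) _ mG G0.
    exact: (measurableT_comp mdis (@to_others_measurable _ _ _ _ _ X i0)).
  - apply/measurable_EFinP; apply: measurable_funM; last exact: measurable_indic.
    have mVT : measurable_fun setT (Vi : T -> R).
      exact: (@measurable_coord_sum _ _ _ _ _ X (fun=> id) b (fun j => j != i0)).
    apply: measurable_funM => //; apply: measurable_funM => //.
    apply: measurable_funD => //; apply: measurable_funM => //.
    exact: measurableT_comp.
  - move=> w _; rewrite indicE; have [Dw|Dw] := boolP (w \in D Q0).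
      rewrite mulr1.
      have h1 := ball i0 (Si w) (Vi w) a0 ba.
      apply: le_trans h1.
      set Bw := [set x | _].
      have mBw : measurable Bw.
        rewrite /Bw -[X in measurable X]setTI.
        by apply: measurable_fun_ler => //; apply: measurableT_comp => //;
          apply: measurable_funD => //; exact: measurable_funM.
      rewrite -(setIT Bw) -integral_indic//.
      apply: ge0_le_integral => //.
      + apply: (measurableT_comp mG).
        by apply/measurable_fun_pairP; split; [exact: measurable_id|exact: measurable_cst].
      + by apply/measurable_EFinP; exact: measurable_indic.
      + move=> x _; rewrite lee_fin !indicE ler_nat.
        have [|//] := boolP ((x, w) \in W); rewrite inE => -[] /= h1' _.
        by rewrite mem_set.
    rewrite mulr0 (_ : (\int[_]_x _)%E = 0%E)//.
    rewrite -[RHS](integral0 (distribution P (X i0)) setT).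
    apply: eq_integral => x _; rewrite indicE.
    have [|//] := boolP (_ \in W); rewrite inE => -[_] /= h1.
    by move: Dw; rewrite notin_setE.
have iVi2 := linear_form_sqr (fun j => j != i0).
have [iV EV] := iVi2.
have mVT : measurable_fun setT (fun w => \sum_(j < n | j != i0) b j * X j w).
  exact: (@measurable_coord_sum _ _ _ _ _ X (fun=> id) b (fun j => j != i0)).
have mVa : measurable_fun setT (fun w : T => `|Vi w|).
  exact: (measurableT_comp (@normr_measurable R setT) mVT).
have mI : measurable_fun setT (\1_(D Q0) : T -> R) by exact: measurable_indic.
have I2 : (fun w => \1_(D Q0) w ^+ 2) = (\1_(D Q0) : T -> R).
  by apply/funext => w; rewrite indicE; case: (_ \in _); rewrite ?expr1n ?expr0n.
have V2 : (fun w => `|Vi w| ^+ 2) = (fun w => (\sum_(j < n | j != i0) b j * X j w) ^+ 2).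
  by apply/funext => w; rewrite real_normK ?num_real.
have iVa2 : intg (fun w => `|Vi w| ^+ 2) by rewrite V2.
have iI2 : intg (fun w => \1_(D Q0) w ^+ 2) by rewrite I2; exact: intg_indic.
have iVI : intg (fun w => `|Vi w| * \1_(D Q0) w) by exact: intg_sqr_mul.
have iI : intg (\1_(D Q0) : T -> R) by exact: intg_indic.
have bndE : (fun w => bnd w * \1_(D Q0) w) = (fun w =>
    4 * M / `|a i0| * (`|Vi w| * \1_(D Q0) w) + 4 * `|b i0| / `|a i0| * \1_(D Q0) w).
  by apply/funext => w; rewrite /bnd; ring.
have ibnd : intg (fun w => bnd w * \1_(D Q0) w).
  by rewrite bndE; apply: intgD; exact: intgZl.
rewrite -[leLHS]fineK; last exact: integrable_fin_num.
rewrite lee_fin -/(Rintegral P setT _) bndE meanD; [|exact: intgZl..].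
rewrite !meanZl//.
have PD : E \1_(D Q0) <= K * (a i0 ^+ 2 / N ^+ 2).
  by rewrite -lee_fin mean_indic//; exact: small_weight_probability.
(* This k balances a second moment B^2/M^2 and a probability (a_i0/N)^2. *)
have k0 : 0 < `|a i0| * M / (N * B) by rewrite divr_gt0// mulr_gt0.
have := mean_mul_le k0 mVa mI iVa2 iI2.
rewrite I2 V2 => EVI.
have aE : a i0 ^+ 2 = `|a i0| ^+ 2 by rewrite real_normK ?num_real.
have PD2 : 4 * `|b i0| / `|a i0| * E \1_(D Q0) <= 4 * K * (B / N).
  apply: (@le_trans _ _ (4 * `|b i0| / `|a i0| * (K * (a i0 ^+ 2 / N ^+ 2)))).
    by rewrite ler_wpM2l// divr_ge0// mulr_ge0.
  have -> : 4 * `|b i0| / `|a i0| * (K * (a i0 ^+ 2 / N ^+ 2)) =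
      4 * K * (`|a i0| / N * (`|b i0| / N)) by rewrite aE; field; rewrite !gt_eqF.
  by rewrite ler_wpM2l// mulr_ge0.
have E1 : `|a i0| * M / (N * B) *
    E (fun w => (\sum_(j < n | j != i0) b j * X j w) ^+ 2) <=
    Cx * (`|a i0| * B / (N * M)).
  apply: (@le_trans _ _ (`|a i0| * M / (N * B) * (Cx / M ^+ 2 * B ^+ 2))).
    rewrite ler_wpM2l ?(ltW k0)//; apply: (le_trans EV).
    rewrite ler_wpM2l ?divr_ge0 ?sqr_ge0//; apply: le_trans bB.
    by rewrite [leRHS](bigD1 i0)//= lerDr sqr_ge0.
  by rewrite le_eqVlt; apply/orP; left; apply/eqP; field; rewrite !gt_eqF.
have E2 : (`|a i0| * M / (N * B))^-1 * E \1_(D Q0) <= K * (`|a i0| * B / (N * M)).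
  apply: (@le_trans _ _ ((`|a i0| * M / (N * B))^-1 * (K * (a i0 ^+ 2 / N ^+ 2)))).
    by rewrite ler_wpM2l// invr_ge0 ltW.
  by rewrite le_eqVlt; apply/orP; left; apply/eqP; rewrite aE; field; rewrite !gt_eqF.
have E3 : E (fun w => `|Vi w| * \1_(D Q0) w) <= (Cx + K) * (`|a i0| * B / (N * M)) / 2.
  by apply: (le_trans EVI); rewrite ler_wpM2r// mulrDl lerD.
have E4 : 4 * M / `|a i0| * E (fun w => `|Vi w| * \1_(D Q0) w) <= 2 * (Cx + K) * (B / N).
  apply: (@le_trans _ _ (4 * M / `|a i0| * ((Cx + K) * (`|a i0| * B / (N * M)) / 2))).
    by rewrite ler_wpM2l// divr_ge0// mulr_ge0// ltW.
  by rewrite le_eqVlt; apply/orP; left; apply/eqP; field; rewrite !gt_eqF.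
by rewrite [leRHS]mulrDl lerD.
Qed.

Lemma linear_form_comparison :
  (P A <= (comparison_constant Ch Cq Cx * (B / N))%:E)%E.
Proof.
have -> : A = (A `\` D Q0) `|` (A `&` D Q0) by rewrite setUC setUIDK.
apply: (le_trans (measureU2 _ _ _)).
- by apply: measurableD.
- exact: measurableI.
- rewrite /comparison_constant mulrDl EFinD.
  apply: leeD; first exact: large_weight_event.
  exact: small_weight_event.
Qed.

End two_linear_forms.

(** * The theorem *)

Theorem theorem3 (R : realType) :
  exists C : R, 0 < C /\
    forall (n : nat) (d : measure_display) (T : measurableType d)
      (P : probability T R) (X : 'I_n -> {RV P >-> R}) (f : R -> R)
      (alpha beta : 'rV[R]_n),
      (1 <= n)%N ->
      mutually_independent X ->
      identically_distributed X ->
      (forall i, nondegenerate_law (X i)) ->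
      (forall i, has_density (X i) f) ->
      log_concave f ->
      even_function f ->
      alpha != 0 ->
      (P [set w | (`|lin_form alpha X w| <= `|lin_form beta X w|)%R] <=
        (C * (euclid_norm beta / euclid_norm alpha))%:E)%E.
Proof.
pose Ch : R := 576; pose Cq : R := 9216; pose Cx : R := 72.
have [Ch0 Cq0 Cx0] : [/\ 0 <= Ch, 0 <= Cq & 0 <= Cx] by split; exact: ler0n.
exists (comparison_constant Ch Cq Cx).
have C0 := comparison_constant_gt0 Ch0 Cq0 Cx0; split => //.
move=> n d T P X f alpha beta n1 indX _ _ Xf lcf evf alpha0.
pose i1 : 'I_n := Ordinal n1.
have f0 x : 0 <= f x by have [_ h _] := Xf i1; exact: h.
have M0 : 0 < f 0 := mode_density_gt0 lcf evf f0 (integral_density1 (Xf i1)).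
set C := comparison_constant _ _ _ in C0 *.
have /choice[h /choice[q hq]] := fun i => score_exists (Xf i) lcf evf.
have sum0 (c : 'rV[R]_n) : 0 <= \sum_(i < n) c 0 i ^+ 2.
  by apply: sumr_ge0 => i _; exact: sqr_ge0.
have sqrE (c : 'rV[R]_n) : \sum_(i < n) c 0 i ^+ 2 = euclid_norm c ^+ 2.
  by rewrite sqr_sqrtr.
set N := euclid_norm alpha; set B0 := euclid_norm beta.
have N0 : 0 < N.
  rewrite /N sqrtr_gt0 lt_def sum0 andbT; apply: contra alpha0 => /eqP s0.
  apply/eqP/rowP => i; rewrite mxE.
  have /(_ i isT)/eqP := psumr_eq0P (fun i _ => sqr_ge0 (alpha 0 i)) s0.
  by rewrite sqrf_eq0 => /eqP.
have B00 : 0 <= B0 by exact: sqrtr_ge0.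
pose i0 := [arg max_(i > i1) alpha 0 i ^+ 2]%O.
have a_max i : alpha 0 i ^+ 2 <= alpha 0 i0 ^+ 2.
  by rewrite /i0; case: arg_maxP => // j _; apply.
have main B : B0 < B ->
    (P [set w | (`|lin_form alpha X w| <= `|lin_form beta X w|)%R] <=
      (C * (B / N))%:E)%E.
  move=> B0B; have Bp : 0 < B by exact: le_lt_trans B0B.
  apply: (@linear_form_comparison R d T P n X indX (f 0) Ch Cq Cx h q) => //.
  - by move=> i; have [[]] := hq i.
  - by move=> i; have [[]] := hq i.
  - by move=> i; have [[]] := hq i.
  - by move=> i; have [[]] := hq i.
  - by move=> i; have [[]] := hq i.
  - by move=> i; have [_] := hq i.
  - by move=> i; exact: law_mean0 (Xf i) lcf evf.
  - by move=> i; exact: law_second_moment (Xf i) lcf evf.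
  - by rewrite sqrE lerXn2r ?nnegrE// ltW.
  - by move=> i a b s t; exact: law_small_ball.
clearbody C.
(* The positive B of the comparison absorbs the case beta = 0. *)
apply/lee_addgt0Pr => e e0.
apply: le_trans (main (B0 + e * N / C) _) _.
  by rewrite ltrDl divr_gt0// mulr_gt0.
rewrite -EFinD lee_fin le_eqVlt; apply/orP; left; apply/eqP.
by field; rewrite !gt_eqF.
Qed.
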